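(* Let $\mathcal{E}:\mathcal{C}_{2n}\to\mathcal{C}_{2n}$ be a Gaussian map specified by $$\mathcal{E}(X)(\theta)=C\int\exp\left[S(\theta,\eta)+i\eta^T\mu\right]X(\mu)\,D\eta\,D\mu,\qquad S(\theta,\eta)=\frac{i}{2}(\theta^T,\eta^T)\begin{pmatrix}A&B\\-B^T&D\end{pmatrix}\begin{pmatrix}\theta\\\eta\end{pmatrix},$$ where $A,B,D$ are complex $2n\times 2n$ matrices with $A,D$ antisymmetric, and $C$ is a complex number. Then $\mathcal{E}$ is completely positive if and only if (i) $C\ge0$ and (ii) the matrix $$M=\begin{pmatrix}A&B\\-B^T&D\end{pmatrix}$$ is real and satisfies $M^TM\le I$.
   Context: $\mathcal{C}_{2n}$ is the complex unital algebra generated by Hermitian $\hat c_1,\dots,\hat c_{2n}$ with $\hat c_a\hat c_b+\hat c_b\hat c_a=2\delta_{ab}\hat I$; it is identified with the algebra of all linear operators on the $2^n$-dimensional Fock space of $n$ fermionic modes. The Grassmann representation $X(\theta)$ of $X\in\mathcal{C}_{2n}$ is the image of $X$ under the linear isomorphism from $\mathcal{C}_{2n}$ to the complex Grassmann (exterior) algebra $\mathcal{G}_{2n}$ with anticommuting generators $\theta_1,\dots,\theta_{2n}$ sending $\hat I\mapsto1$ and $\hat c_{a_1}\cdots\hat c_{a_p}\mapsto\theta_{a_1}\cdots\theta_{a_p}$ for $a_1<\dots<a_p$; $X(\mu)$ is the same polynomial in anticommuting variables $\mu_1,\dots,\mu_{2n}$. The variables $\theta_a,\eta_a,\mu_a$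 ($a=1,\dots,2n$) are $6n$ mutually anticommuting Grassmann generators. $\theta^TN\theta=\sum_{a,b}N_{ab}\theta_a\theta_b$, $\eta^T\mu=\sum_a\eta_a\mu_a$, and likewise for other forms; exponentials are finite Taylor series. Partial derivatives are left derivatives: $\partial_{\theta_a}1=0$, $\partial_{\theta_a}(\theta_bf)=\delta_{ab}f-\theta_b\partial_{\theta_a}f$. Berezin integration is $\int d\theta_a=\partial/\partial\theta_a$, $\int D\theta=\int d\theta_{2n}\cdots\int d\theta_1$, so $\int D\theta\,\theta_1\cdots\theta_{2n}=1$. Gaussian map: a linear map $\mathcal{E}:\mathcal{C}_{2n}\to\mathcal{C}_{2n}$ admitting an integral representation of the displayed form for some complex $2n\times2n$ matrices $A,B,D$ ($A,D$ may be and are taken antisymmetric) and some complex number $C$. A linear map $\mathcal{E}:\mathcal{C}_{2n}\to\mathcal{C}_{2n}$ is completely positive iff $\mathcal{E}\otimes Id:\mathcal{C}_{2n}\otimes\mathcal{C}_{2n}\to\mathcal{C}_{2n}\otimes\mathcal{C}_{2n}$ is positive (maps non-negative operators to non-negative operators), where $\otimes$ is the ordinary (ungraded) tensor product and $Id$ is the identity map.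
   Formalization: The ''only if'' direction is stated for C ≠ 0 only: when C = 0 the map is zero, hence completely positive for every A, B, D, even if M is not real or M^T M ≤ I fails. The ''if'' direction is kept for every complex C. *)

(* Defs.v *)
From HB Require Import structures.
From mathcomp Require Import all_boot all_order all_algebra.
From mathcomp Require Import complex mxtens reals.
From mathcomp Require Import ring.

Set Implicit Arguments.
Unset Strict Implicit.
Unset Printing Implicit Defensive.

Import Order.TTheory GRing.Theory Num.Theory.
Local Open Scope ring_scope.
Local Open Scope sesquilinear_scope.

(* An element f of grassmann K N stands for \sum_S f S *: theta_S, where       *)
(* theta_S is the product of the generators theta_a, a in S, taken in          *)
(* increasing order of a (see grassmann_decomp below).                         *)
Definition grassmann (K : fieldType) (N : nat) := {ffun {set 'I_N} -> K}.

Section GrassmannRing.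
Variables (K : fieldType) (N : nat).
Implicit Types (S T U V W : {set 'I_N}) (f g h : grassmann K N).

HB.instance Definition _ :=
  GRing.Lmodule.copy (grassmann K N) {ffun {set 'I_N} -> K^o}.

(* theta_T * theta_U = gsign T U *: theta_(T :|: U) when T and U are disjoint. *)
Definition gsign T U : K :=
  \prod_(a in T) \prod_(b in U) (-1) ^+ (b < a)%N.

Definition gmul f g : grassmann K N :=
  [ffun S : {set 'I_N} => \sum_(T : {set 'I_N} | T \subset S)
     gsign T (S :\: T) * (f T * g (S :\: T))].

Definition gone : grassmann K N := [ffun S : {set 'I_N} => (S == set0)%:R].

Lemma gsign0r T : gsign T set0 = 1.
Proof. by rewrite /gsign big1 // => a _; rewrite big_set0. Qed.

Lemma gsign0l T : gsign set0 T = 1.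
Proof. by rewrite /gsign big_set0. Qed.

Lemma gsignUl T W U : [disjoint T & W] ->
  gsign (T :|: W) U = gsign T U * gsign W U.
Proof. by move=> d; rewrite /gsign -bigU //=; apply: eq_bigl => a; rewrite !inE. Qed.

Lemma gsignUr T W U : [disjoint W & U] ->
  gsign T (W :|: U) = gsign T W * gsign T U.
Proof.
move=> dWU; rewrite /gsign -big_split /=; apply: eq_bigr => a _.
by rewrite -bigU //=; apply: eq_bigl => b; rewrite !inE.
Qed.

Lemma gmulA : associative gmul.
Proof.
move=> f g h; apply/ffunP => S; rewrite !ffunE.
under eq_bigr do rewrite ffunE !mulr_sumr.
under [RHS]eq_bigr do rewrite ffunE mulr_suml mulr_sumr.
rewrite [RHS](exchange_big_dep (fun T : {set 'I_N} => T \subset S)) /=; last first.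
  by move=> V T VS TV; apply: subset_trans VS.
apply: eq_bigr => T TS.
rewrite (reindex_onto (fun V : {set 'I_N} => V :\: T) (fun W => T :|: W)) /=; last first.
  move=> W; rewrite subsetD => /andP[_ dWT].
  by rewrite setDUl setDv set0U; apply/setDidPl.
apply: eq_big => [V|V /andP[VS /eqP defV]].
  apply/andP/andP.
    case=> VS /eqP defV; split; last by rewrite -defV subsetUl.
    rewrite -defV subUset TS; exact: subset_trans VS (subsetDl _ _).
  case=> VS TV; split; first exact: setSD.
  by apply/eqP; rewrite -{2}(setID V T) (setIidPr TV).
have TV : T \subset V by rewrite -defV subsetUl.
have VS' : V \subset S.
  by rewrite -defV subUset TS; apply: subset_trans VS (subsetDl _ _).
set W := V :\: T; set U := S :\: V.
have defU : S :\: T :\: W = U.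
  by rewrite /U /W setDDl defV.
have dWU : [disjoint W & U].
  by rewrite -defU disjoints_subset setDE setCI setCK subsetUr.
have dTW : [disjoint T & W].
  by rewrite disjoints_subset /W setDE setCI setCK subsetUr.
have defST : S :\: T = W :|: U.
  by rewrite -defU -{1}(setID (S :\: T) W) (setIidPr _).
have -> : gsign V U = gsign T U * gsign W U by rewrite -gsignUl // defV.
by rewrite defU defST gsignUr //; ring.
Qed.

Lemma gmul1l : left_id gone gmul.
Proof.
move=> f; apply/ffunP => S; rewrite ffunE (bigD1 set0) ?sub0set //=.
rewrite ffunE eqxx gsign0l setD0 !mul1r big1 ?addr0 // => T /andP[_ /negPf T0].
by rewrite ffunE T0 mul0r mulr0.
Qed.

Lemma gmul1r : right_id gone gmul.
Proof.
move=> f; apply/ffunP => S; rewrite ffunE (bigD1 S) //=.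
rewrite setDv ffunE eqxx gsign0r mul1r mulr1 big1 ?addr0 // => T /andP[TS nTS].
rewrite ffunE setD_eq0; case: (boolP (S \subset T)) => [ST|_]; last by rewrite !mulr0.
by case/eqP: nTS; apply/eqP; rewrite eqEsubset TS.
Qed.

Lemma gmulDl : left_distributive gmul +%R.
Proof.
move=> f g h; apply/ffunP => S; rewrite !ffunE -big_split /=.
by apply: eq_bigr => T _; rewrite ffunE; ring.
Qed.

Lemma gmulDr : right_distributive gmul +%R.
Proof.
move=> f g h; apply/ffunP => S; rewrite !ffunE -big_split /=.
by apply: eq_bigr => T _; rewrite ffunE; ring.
Qed.

Lemma gone_neq0 : gone != 0.
Proof.
apply/eqP => /ffunP/(_ set0); rewrite !ffunE eqxx => /eqP.
by rewrite oner_eq0.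
Qed.

HB.instance Definition _ := GRing.Zmodule_isNzRing.Build (grassmann K N)
  gmulA gmul1l gmul1r gmulDl gmulDr gone_neq0.

Lemma gscaleAl (a : K) f g : a *: (f * g) = a *: f * g.
Proof.
apply/ffunP => S; rewrite !ffunE [LHS]mulr_sumr.
by apply: eq_bigr => T _; rewrite ffunE /GRing.scale /=; ring.
Qed.

HB.instance Definition _ :=
  GRing.Lmodule_isLalgebra.Build K (grassmann K N) gscaleAl.

Lemma gscaleAr (a : K) f g : a *: (f * g) = f * (a *: g).
Proof.
apply/ffunP => S; rewrite !ffunE [LHS]mulr_sumr.
by apply: eq_bigr => T _; rewrite ffunE /GRing.scale /=; ring.
Qed.

HB.instance Definition _ :=
  GRing.Lalgebra_isAlgebra.Build K (grassmann K N) gscaleAr.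

Definition gvar (a : 'I_N) : grassmann K N :=
  [ffun S : {set 'I_N} => (S == [set a])%:R].

Definition gmon S : grassmann K N := \prod_(a <- enum S) gvar a.

(* Left derivative: d_a theta_(a |: S) = gsign [set a] S *: theta_S if a is    *)
(* not in S, since theta_a * theta_S = gsign [set a] S *: theta_(a |: S).      *)
Definition gderiv (a : 'I_N) f : grassmann K N :=
  [ffun S : {set 'I_N} =>
     if a \in S then 0 else gsign [set a] S * f (a |: S)].

Lemma gsign1E a S : gsign [set a] S = \prod_(b in S) (-1) ^+ (b < a)%N.
Proof. by rewrite /gsign big_set1. Qed.

Lemma gsign1_sqr a S : gsign [set a] S * gsign [set a] S = 1.
Proof.
rewrite gsign1E -big_split big1 //= => b _.
by rewrite -exprD addnn -signr_odd odd_double expr0.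
Qed.

Lemma gsign11C a b : a != b ->
  gsign [set a] [set b] * gsign [set b] [set a] = -1.
Proof.
move=> ab; rewrite !gsign1E !big_set1 -exprD -signr_odd.
have: (a : nat) != b by [].
by case: ltngtP.
Qed.

Lemma gsign1D1 a b S : b \in S ->
  gsign [set a] S = gsign [set a] [set b] * gsign [set a] (S :\ b).
Proof.
move=> bS; rewrite -{1}(setD1K bS) gsignUr // disjoints_subset sub1set.
by rewrite !inE eqxx.
Qed.

Lemma gvarM a f S :
  (gvar a * f) S = if a \in S then gsign [set a] (S :\ a) * f (S :\ a) else 0.
Proof.
rewrite ffunE; case: ifP => aS.
  rewrite (bigD1 [set a]) ?sub1set //= ffunE eqxx mul1r big1 ?addr0 //.
  by move=> T /andP[_ /negPf nT]; rewrite ffunE nT mul0r mulr0.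
rewrite big1 // => T TS; rewrite ffunE; case: eqP => [defT|_].
  by move: TS; rewrite defT sub1set aS.
by rewrite mul0r mulr0.
Qed.

Lemma gmonE S T : gmon S T = (T == S)%:R.
Proof.
have ss : sorted (fun a b : 'I_N => (a < b)%N) (enum S).
  rewrite /enum_mem sorted_filter //; first by move=> ? ? ?; apply: ltn_trans.
  by have := iota_ltn_sorted 0 N; rewrite -val_enum_ord sorted_map enumT.
rewrite /gmon -{2}(set_enum S); elim: (enum S) T ss => [|a s IH] T ss.
  rewrite big_nil ffunE; congr (_ == _)%:R.
have lt_as b : b \in s -> (a < b)%N.
  by move: ss; rewrite /= path_sortedE => [/andP[/allP/(_ b)]|? ? ?] //; apply: ltn_trans.
have nas : a \notin [set:: s] by rewrite inE; apply/negP => /lt_as; rewrite ltnn.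
rewrite big_cons gvarM set_cons; case: ifP => aT; last first.
  by case: eqP => // defT; rewrite defT !inE eqxx in aT.
rewrite IH ?(path_sorted ss) //.
have -> : (T == a |: [set:: s]) = (T :\ a == [set:: s]).
  apply/eqP/eqP => [->|<-]; last by rewrite setD1K.
  by rewrite setU1K.
case: eqP => [->|_]; last by rewrite mulr0.
rewrite mulr1 gsign1E big1 // => b; rewrite inE => /lt_as.
by rewrite ltnNge => /negPf; rewrite leq_eqVlt => /norP[_ /negPf ->].
Qed.

Lemma grassmann_decomp f : f = \sum_S f S *: gmon S.
Proof.
apply/ffunP => T; rewrite sum_ffunE (bigD1 T) //= ffunE gmonE eqxx.
rewrite [X in X + _]mulr1 big1 ?addr0 // => S /negPf nST.
by rewrite ffunE gmonE eq_sym nST [LHS]mulr0.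
Qed.

Lemma gvar_sqr a : gvar a * gvar a = 0.
Proof.
apply/ffunP => S; rewrite gvarM !ffunE; case: ifP => // aS.
case: eqP; last by rewrite mulr0.
by move=> /setP/(_ a); rewrite !inE eqxx.
Qed.

Lemma gvar_anticomm a b : gvar a * gvar b = - (gvar b * gvar a).
Proof.
have [<-|ab] := eqVneq a b; first by rewrite gvar_sqr oppr0.
have gE x y S : x != y ->
    (gvar x * gvar y) S = (S == [set x; y])%:R * gsign [set x] [set y].
  move=> xy; rewrite gvarM ffunE.
  have nxy : x \notin [set y] by rewrite inE.
  case: ifP => xS.
    have -> : (S == [set x; y]) = (S :\ x == [set y]).
      apply/eqP/eqP => [->|<-]; last by rewrite setD1K.
      by rewrite setU1K.
    by case: eqP => [->|_]; rewrite ?mulr1 ?mul1r ?mulr0 ?mul0r.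
  by case: eqP => [eS|_]; rewrite ?mul0r //; rewrite eS !inE eqxx in xS.
apply/ffunP => S; rewrite gE // [RHS]ffunE gE; last by rewrite eq_sym.
rewrite [[set b; a]]setUC -mulrN; congr (_ * _).
have := gsign11C ab; move/(congr1 ( *%R^~ (gsign [set b] [set a]))).
by rewrite /= -mulrA gsign1_sqr mulr1 mulN1r.
Qed.

Lemma gderiv1 a : gderiv a 1 = 0.
Proof.
apply/ffunP => S; rewrite [LHS]ffunE [RHS]ffunE; case: ifP => // _.
rewrite ffunE; case: eqP => [/setP/(_ a)|_]; last by rewrite mulr0.
by rewrite !inE eqxx.
Qed.

Lemma gderivM a b f :
  gderiv a (gvar b * f) = (a == b)%:R *: f - gvar b * gderiv a f.
Proof.
have gderivE g T :
  gderiv a g T = if a \in T then 0 else gsign [set a] T * g (a |: T).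
  by rewrite ffunE.
have subE g h T : (g - h) T = g T - h T by rewrite 2!ffunE.
have scE (k : K) g T : (k *: g) T = k * g T by rewrite ffunE.
apply/ffunP => S; rewrite subE scE gderivE !gvarM gderivE !inE.
have [<-|ab] := eqVneq a b.
  rewrite /= mul1r; case: ifP => aS.
    by rewrite setD1K // mulrA gsign1_sqr mul1r subrr.
  by rewrite setU1K ?aS // mulrA gsign1_sqr mul1r subr0.
rewrite mul0r sub0r /=.
case: (boolP (b \in S)) => bS; last by rewrite mulr0 oppr0; case: ifP.
case: ifP => aS; first by rewrite mulr0 oppr0.
have -> : (a |: S) :\ b = a |: (S :\ b).
  apply/setP => x; rewrite !inE; case: (eqVneq x a) => [->|//].
  by rewrite ab.
rewrite (gsign1D1 a bS) (gsign1D1 b (setU11 a _)) setU1K ?inE ?ab ?aS //.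
have := gsign11C ab.
set u := gsign [set a] [set b]; set v := gsign [set b] [set a] => uv.
set x := gsign _ _; set y := gsign _ _; set z := f _.
have -> : u * x * (v * y * z) = (u * v) * (x * y * z) by ring.
by rewrite uv mulN1r mulrA [y * x]mulrC.
Qed.

(* The Berezin integral \int d x_(r-1) ... \int d x_0 f over the generators   *)
(* x_0, ..., x_(r-1) listed in s; the innermost integral \int d x_0 acts first. *)
Definition berezin (s : seq 'I_N) f : grassmann K N :=
  foldl (fun g a => gderiv a g) f s.

Lemma gderiv_notin a s : a \notin s -> gderiv a (\prod_(b <- s) gvar b) = 0.
Proof.
elim: s => [|b s IH]; first by rewrite big_nil gderiv1.
rewrite inE negb_or big_cons gderivM => /andP[/negPf -> /IH ->].
by rewrite scale0r mulr0 subr0.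
Qed.

Lemma berezin_prod s : uniq s -> berezin s (\prod_(a <- s) gvar a) = 1.
Proof.
elim: s => [|a s IH] /=; first by rewrite big_nil.
case/andP => nas /IH IHs; rewrite big_cons /berezin /= gderivM eqxx.
by rewrite gderiv_notin // mulr0 subr0 scale1r.
Qed.

(* The Taylor series of exp. It is truncated at degree N, which loses nothing  *)
(* when f has no constant term, since then f ^+ N.+1 = 0.                      *)
Definition gexp f : grassmann K N :=
  \sum_(k < N.+1) (k`!%:R)^-1 *: f ^+ k.

Lemma gexp_trunc f k : f set0 = 0 -> (N < k)%N -> f ^+ k = 0.
Proof.
move=> f0; have low j S : (#|S| < j)%N -> (f ^+ j) S = 0.
  elim: j S => // j IH S Sj; rewrite exprS ffunE big1 // => T TS.
  have [->|T0] := eqVneq T set0; first by rewrite f0 mul0r mulr0.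
  rewrite IH ?mulr0 //; rewrite -ltnS; apply: leq_trans Sj.
  by rewrite ltnS cardsD (setIidPr TS) ltn_subrL !card_gt0 T0 (subset_neq0 TS).
move=> Nk; apply/ffunP => S; rewrite low ?ffunE //; apply: leq_ltn_trans Nk.
by rewrite -[X in (_ <= X)%N]card_ord; apply: max_card.
Qed.

Definition gbilin (p q : nat) (u : 'I_p -> grassmann K N) (A : 'M[K]_(p, q))
    (v : 'I_q -> grassmann K N) : grassmann K N :=
  \sum_a \sum_b A a b *: (u a * v b).
End GrassmannRing.

(* The polynomial f in the variables v_0, ..., v_(m-1) instead of the          *)
(* generators of grassmann K m.                                                *)
Definition gsubst (K : fieldType) (m N : nat) (v : 'I_m -> grassmann K N)
    (f : grassmann K m) : grassmann K N :=
  \sum_(S : {set 'I_m}) f S *: \prod_(a <- enum S) v a.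

Section Clifford.
Variables (K : numClosedFieldType) (n : nat).

(* Operators on the 2^n-dimensional Fock space are 'M[K]_(2 ^ n). Families c   *)
(* exist (clifford_generators_exist), and the ordered products of any such     *)
(* family form a basis of 'M[K]_(2 ^ n) (grassmann_rep_bij).                   *)
Definition clifford_generators (c : 'I_(2 * n) -> 'M[K]_(2 ^ n)) : Prop :=
  (forall a, (c a)^t* = c a) /\
  (forall a b, c a *m c b + c b *m c a = (2 * (a == b)%:R)%:M).

Variable c : 'I_(2 * n) -> 'M[K]_(2 ^ n).

Definition cmon (S : {set 'I_(2 * n)}) : 'M[K]_(2 ^ n) :=
  \prod_(a <- enum S) c a.

(* The coefficient of theta_S in X(theta) is read off by the normalized trace  *)
(* inner product with cmon S. By grassmann_rep_cmon and grassmann_rep_bij this *)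
(* is the linear isomorphism sending cmon S to theta_S.                        *)
Definition grassmann_rep (X : 'M[K]_(2 ^ n)) : grassmann K (2 * n) :=
  [ffun S : {set 'I_(2 * n)} => (2 ^ n)%:R^-1 * \tr ((cmon S)^t* *m X)].

Hypothesis cP : clifford_generators c.

Lemma generator_sqr a : c a *m c a = 1%:M.
Proof.
have := cP.2 a a; rewrite eqxx mulr1 -mulr2n -scaler_nat => /(congr1 ( *:%R 2^-1)).
by rewrite scalerA mulVf ?pnatr_eq0 // scale1r -scalemx1 scalerA mulVf ?pnatr_eq0 // scale1r.
Qed.

Lemma generator_anticomm a b : a != b -> c a *m c b = - (c b *m c a).
Proof.
move=> ab; apply/eqP; rewrite -subr_eq0 opprK cP.2 (negPf ab) mulr0.
by rewrite raddf0.
Qed.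

Lemma trmxC_mul p q r (A : 'M[K]_(p, q)) (B : 'M[K]_(q, r)) :
  (A *m B)^t* = B^t* *m A^t*.
Proof. by rewrite trmx_mul map_mxM. Qed.

Lemma cmon_unitary S : (cmon S)^t* *m cmon S = 1%:M.
Proof.
rewrite /cmon; elim: (enum S) => [|a s IH].
  by rewrite big_nil trmx1 map_mx1 mulmx1.
rewrite big_cons -mulmxE trmxC_mul cP.1 mulmxA -(mulmxA _ (c a) (c a)).
by rewrite generator_sqr mulmx1.
Qed.

Lemma generator_cmon a S :
  c a *m cmon S = (-1) ^+ (#|S| + (a \in S)) *: (cmon S *m c a).
Proof.
have -> : (-1) ^+ (#|S| + (a \in S)) =
    (-1) ^+ (size (enum S) + count_mem a (enum S)) :> K.
  by rewrite -cardE (count_uniq_mem _ (enum_uniq _)) mem_enum.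
rewrite /cmon; elim: (enum S) => [|b s IH].
  by rewrite big_nil scale1r mulmx1 mul1mx.
rewrite big_cons -mulmxE mulmxA /=; have [<-|ab] := eqVneq a b.
  rewrite -[LHS]mulmxA [X in c a *m X]IH -scalemxAr mulmxA; congr (_ *: _).
  by rewrite /= !addSn !addnS /= !exprS !mulN1r opprK.
rewrite /= generator_anticomm // mulNmx -[X in - X = _]mulmxA IH -scalemxAr.
by rewrite addSn exprS mulN1r scaleNr mulmxA.
Qed.

Lemma cmon_orth S T : \tr ((cmon T)^t* *m cmon S) = (2 ^ n)%:R * (S == T)%:R.
Proof.
have [->|nST] := eqVneq S T; first by rewrite cmon_unitary mxtrace1 mulr1.
have [a oa] : exists a, odd (#|S| + (a \in S) + (#|T| + (a \in T))).
  case: (boolP (odd (#|S| + #|T|))) => oST; last first.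
    have [a ha] : exists a, (a \in S) != (a \in T).
      apply/existsP; apply: contraNT nST => /existsPn h.
      by apply/eqP/setP => a; apply/eqP/negPn/h.
    exists a; rewrite addnACA oddD (negPf oST) /=.
    by move: ha; do 2 case: (a \in _).
  suff [a ha] : exists a, (a \in S) == (a \in T).
    by exists a; rewrite addnACA oddD oST (eqP ha) addnn odd_double.
  apply/existsP; apply: contraLR oST => /existsPn h.
  have -> : T = ~: S.
    by apply/setP => a; rewrite inE; have := h a; do 2 case: (a \in _).
  by rewrite cardsC card_ord oddM.
set x := \tr _; rewrite mulr0; suff: x = - x.
  by move/eqP; rewrite -addr_eq0 -mulr2n mulrn_eq0 => /eqP.
have conjS e U : ((-1) ^+ e *: U : 'M[K]_(2 ^ n))^t* = (-1) ^+ e *: U^t*.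
  by apply/matrixP => i j; rewrite !mxE rmorphM rmorphXn rmorphN1.
have gT : (cmon T)^t* *m c a = (-1) ^+ (#|T| + (a \in T)) *: (c a *m (cmon T)^t*).
  by have := congr1 (fun Z => Z^t*) (generator_cmon a T); rewrite conjS !trmxC_mul !cP.1.
have y1 : \tr ((cmon T)^t* *m c a *m cmon S *m c a) =
    (-1) ^+ (#|T| + (a \in T)) * x.
  rewrite gT -!scalemxAl mxtraceZ mxtrace_mulC !mulmxA generator_sqr mul1mx //.
have y2 : \tr ((cmon T)^t* *m c a *m cmon S *m c a) =
    (-1) ^+ (#|S| + (a \in S)) * x.
  rewrite -(mulmxA _ (c a)) generator_cmon -scalemxAr -scalemxAl mxtraceZ.
  by rewrite -!mulmxA generator_sqr mulmx1.
have := congr1 ( *%R ((-1) ^+ (#|T| + (a \in T)))) (etrans (esym y1) y2).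
rewrite !mulrA -!exprD addnn -signr_odd odd_double expr0 mul1r => e.
by rewrite {1}e -signr_odd addnC oa expr1 mulN1r.
Qed.

Lemma grassmann_rep_is_linear : linear (grassmann_rep : _ -> grassmann K _).
Proof.
move=> k X Y; apply/ffunP => S.
by rewrite !ffunE mulmxDr -scalemxAr mxtraceD mxtraceZ mulrDr mulrCA.
Qed.

HB.instance Definition _ := GRing.isLinear.Build K 'M[K]_(2 ^ n)
  (grassmann K (2 * n)) *:%R grassmann_rep grassmann_rep_is_linear.

Lemma grassmann_rep_cmon S : grassmann_rep (cmon S) = gmon K S.
Proof.
apply/ffunP => T; rewrite ffunE gmonE cmon_orth mulKf ?(eq_sym S) //.
by rewrite pnatr_eq0 -lt0n expn_gt0.
Qed.

Lemma grassmann_rep_bij : bijective grassmann_rep.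
Proof.
pose g (f : grassmann K (2 * n)) : 'M[K]_(2 ^ n) := \sum_S f S *: cmon S.
have gK f : grassmann_rep (g f) = f.
  rewrite /g linear_sum [RHS]grassmann_decomp; apply: eq_bigr => S _.
  by rewrite linearZ /= grassmann_rep_cmon.
pose N := #|{set 'I_(2 * n)}|.
have eN : N = (2 ^ n * 2 ^ n)%N.
  by rewrite /N -cardsT -powersetT card_powerset cardsT card_ord mul2n -addnn expnD.
pose P : 'M[K]_(N, 2 ^ n * 2 ^ n) := \matrix_i mxvec (cmon (enum_val i)).
pose h (u : 'rV[K]_N) : grassmann K (2 * n) := [ffun S => u 0 (enum_rank S)].
have uP u : u *m P = mxvec (g (h u)).
  rewrite mulmx_sum_row /g linear_sum [RHS](reindex _ (onW_bij _ (@enum_val_bij _))) /=.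
  apply: eq_bigr => i _; rewrite linearZ /= rowK ffunE enum_valK //.
have freeP : row_free P.
  rewrite -kermx_eq0; apply/rowV0P => u /sub_kermxP; rewrite uP => /eqP.
  rewrite mxvec_eq0 => /eqP g0; apply/rowP => i.
  have := gK (h u); rewrite g0 linear0 => /ffunP/(_ (enum_val i)).
  by rewrite !ffunE enum_valK mxE => <-.
have fullP : row_full P by move: freeP; rewrite /row_free /row_full {2}eN.
exists g => // X; have /submxP[u] := submx_full (mxvec X) fullP.
by rewrite uP => /(can_inj mxvecK) ->; rewrite gK.
Qed.
End Clifford.

Lemma clifford_generators_exist (K : numClosedFieldType) (n : nat) :
  exists c : 'I_(2 * n) -> 'M[K]_(2 ^ n), clifford_generators c.
Proof.
pose gens m d (c : 'I_m -> 'M[K]_d) := (forall a, (c a)^t* = c a) /\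
  (forall a b, c a *m c b + c b *m c a = (2 * (a == b)%:R)%:M).
pose s (k : 'I_3) : 'M[K]_2 := \matrix_(i, j)
  (if k == 0 then (i != j)%:R else
   if k == 1 then (i != j)%:R * (-1) ^+ (i == 0) * 'i
   else (i == j)%:R * (-1) ^+ (i == 1)).
have sP : gens 3 2 s.
  split=> [[[|[|[]]] //= ha]|[[|[|[]]] //= ha] [[|[|[]]] //= hb]];
  apply/matrixP => -[[|[]] //= hi] [[|[]] //= hj];
  rewrite !mxE ?big_ord_recl ?big_ord0 /= ?mxE /=;
  rewrite ?rmorphM ?rmorphXn ?rmorphN1 ?rmorph0 ?rmorph1 ?[_ 'i]conjCi;
  rewrite ?mulr0 ?mul0r ?expr0 ?expr1 ?mulr1 ?mul1r ?mulN1r ?opprK;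
  by rewrite ?mulr0 ?mulr1 ?mulrN ?mulNr -?expr2 ?sqrCi //; ring.
have tensC p q (A : 'M[K]_p) (B : 'M[K]_q) : (A *t B)^t* = A^t* *t B^t*.
  by rewrite trmx_tens map_mxT.
have tDl p q (A A' : 'M[K]_p) (B : 'M[K]_q) : A *t B + A' *t B = (A + A') *t B.
  by apply/matrixP => i j; rewrite !mxE mulrDl.
have tDr p q (A : 'M[K]_p) (B B' : 'M[K]_q) : A *t B + A *t B' = A *t (B + B').
  by apply/matrixP => i j; rewrite !mxE mulrDr.
have tS p q (x y : K) : (x%:M : 'M[K]_p) *t (y%:M : 'M[K]_q) = (x * y)%:M.
  apply/matrixP => i j; case: (mxtens_indexP i) => i0 i1.
  case: (mxtens_indexP j) => j0 j1; rewrite tensmxE !mxE.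
  rewrite (can_eq (@mxtens_indexK _ _)) xpair_eqE.
  by do 2 case: (_ == _); rewrite ?mulr1n ?mulr0n ?mulr0 ?mul0r.
have ne (k : 'I_2) : (widen_ord (leqnSn 2) k == ord_max) = false.
  by case: k => [[|[]]].
have m0 p : (0%:M : 'M[K]_p) = 0 by rewrite -scalemx1 scale0r.
have sqrE m d (c : 'I_m -> 'M[K]_d) a : gens m d c -> c a *m c a = 1%:M.
  case=> _ /(_ a a); rewrite eqxx mulr1 -mulr2n -scaler_nat.
  move=> /(congr1 ( *:%R 2^-1)); rewrite scalerA mulVf ?pnatr_eq0 // scale1r => ->.
  by rewrite -scalemx1 scalerA mulVf ?pnatr_eq0 // scale1r.
have step m d (c : 'I_m -> 'M[K]_d) :
    gens m d c -> exists c' : 'I_(2 + m) -> 'M[K]_(2 * d), gens _ _ c'.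
  move=> cP; exists (fun i => match split i with
    | inl k => s (widen_ord (leqnSn 2) k) *t 1%:M
    | inr a => s ord_max *t c a end).
  split=> [i|i j].
    by case: (split i) => k; rewrite tensC ?sP.1 ?cP.1 // trmx1 map_mx1.
  rewrite -(can_eq (@splitK 2 m)).
  case: (split i) (split j) => [k|a] [l|b]; rewrite !tensmx_mul ?mulmx1 ?mul1mx.
  - by rewrite tDl sP.2 tS mulr1.
  - by rewrite tDl sP.2 ne mulr0 !m0 tens0mx.
  - by rewrite tDl sP.2 eq_sym ne mulr0 !m0 tens0mx.
  - by rewrite (sqrE _ _ _ _ sP) tDr cP.2 tS mul1r.
change (exists c, gens (2 * n)%N (2 ^ n)%N c).
elim: n => [|n [c /step]]; last by rewrite mulnS expnS.
by exists (fun=> 0); split=> [[]|[]].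
Qed.

Section Positivity.
Variable K : numClosedFieldType.

(* Over an algebraically closed numeric field, 0 <= z entails that z is real,  *)
(* so that a non-negative operator is in particular Hermitian.                 *)
Definition psdmx (d : nat) (Z : 'M[K]_d) : Prop :=
  forall v : 'cV[K]_d, 0 <= (v^t* *m Z *m v) 0 0.

Definition loewner_le (d : nat) (Y Z : 'M[K]_d) : Prop := psdmx (Z - Y).

(* The linear map E (x) F on 'M[K]_(d * e) = 'M[K]_d (x) 'M[K]_e, where the    *)
(* tensor product of matrices is the Kronecker product A *t B.                 *)
Definition tensor_map (d e : nat) (E : 'M[K]_d -> 'M[K]_d)
    (F : 'M[K]_e -> 'M[K]_e) (Z : 'M[K]_(d * e)) : 'M[K]_(d * e) :=
  \sum_i \sum_j \sum_k \sum_l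
    Z (mxtens_index (i, k)) (mxtens_index (j, l)) *:
      (E (delta_mx i j) *t F (delta_mx k l)).

Lemma tensor_mapE (d e : nat) (E : {linear 'M[K]_d -> 'M[K]_d})
    (F : {linear 'M[K]_e -> 'M[K]_e}) (A : 'M[K]_d) (B : 'M[K]_e) :
  tensor_map E F (A *t B) = E A *t F B.
Proof.
rewrite [in RHS](matrix_sum_delta A) [in RHS](matrix_sum_delta B) /tensor_map.
rewrite !linear_sum; apply/matrixP => x y; rewrite [RHS]mxE !summxE big_distrl.
apply: eq_bigr => i _; rewrite !linear_sum !summxE big_distrl.
apply: eq_bigr => j _ /=; rewrite big_distrr summxE; apply: eq_bigr => k _ /=.
rewrite linear_sum !summxE big_distrr; apply: eq_bigr => l _ /=.
by rewrite tensmxE !linearZ !mxE; ring.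
Qed.

Definition completely_positive (d : nat) (E : 'M[K]_d -> 'M[K]_d) : Prop :=
  forall Z : 'M[K]_(d * d), psdmx Z -> psdmx (tensor_map E idfun Z).
End Positivity.

Section Gaussian.
Variables (K : numClosedFieldType) (n : nat).

Definition theta_ix (a : 'I_(2 * n)) : 'I_(2 * n + 2 * n + 2 * n) :=
  lshift _ (lshift _ a).
Definition eta_ix (a : 'I_(2 * n)) : 'I_(2 * n + 2 * n + 2 * n) :=
  lshift _ (rshift _ a).
Definition mu_ix (a : 'I_(2 * n)) : 'I_(2 * n + 2 * n + 2 * n) :=
  rshift _ a.

Local Notation G := (grassmann K (2 * n + 2 * n + 2 * n)).

Definition theta a : G := gvar K (theta_ix a).
Definition eta a : G := gvar K (eta_ix a).
Definition mu a : G := gvar K (mu_ix a).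

(* The column (theta, eta). *)
Definition theta_eta (j : 'I_(2 * n + 2 * n)) : G :=
  match split j with inl a => theta a | inr a => eta a end.

Definition lagrangian (M : 'M[K]_(2 * n + 2 * n)) : G :=
  ('i / 2) *: gbilin theta_eta M theta_eta.

Definition eta_mu : G := \sum_a eta a * mu a.

Definition int_eta (f : G) : G := berezin [seq eta_ix a | a <- enum 'I_(2 * n)] f.
Definition int_mu (f : G) : G := berezin [seq mu_ix a | a <- enum 'I_(2 * n)] f.

(* The map E is given by the Gaussian integral with Lagrangian matrix M and    *)
(* prefactor k; both sides live in the algebra generated by theta, eta, mu.    *)
Definition gaussian_map (c : 'I_(2 * n) -> 'M[K]_(2 ^ n))
    (E : 'M[K]_(2 ^ n) -> 'M[K]_(2 ^ n)) (M : 'M[K]_(2 * n + 2 * n)) (k : K) :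
    Prop :=
  forall X : 'M[K]_(2 ^ n),
    gsubst theta (grassmann_rep c (E X)) =
    k *: int_eta (int_mu (gexp (lagrangian M + 'i *: eta_mu) *
                          gsubst mu (grassmann_rep c X))).
End Gaussian.

(* Main.v *)
(* Integration by parts turns the integral representation into the relations
     d_a E(X) = i sum_b A_ab theta_b E(X) + sum_b B_ab E(d_b X),
     E(theta_a X) = sum_b B_ba theta_b E(X) + i sum_b D_ab E(d_b X),
   where theta_b and d_b act on operators through half the graded
   anticommutator and commutator with c_b. For suitable Clifford generators g on
   the doubled space they say that the Choi matrix J of E satisfies
     J g_a - g_a J = -i sum_b M_ab (g_b J + J g_b),
   which determines the functional tr(J _) up to the factor tr J by Wick's rule
   with two-point function W = 1 - iM.
   If J >= 0 and tr J > 0, then W >= 0, as W_ab is a multiple of tr(J g_a g_b).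
   Conversely, if W = V^* V, then field operators a(v_a) + a^*(v_a) on the Fock
   space over K^N, with v_a the columns of V, have the same Wick rule in the
   vacuum state, so tr(J Y^* Y) is tr J times the square norm of a Fock vector.
   Finally W >= 0 iff M is real and M^T M <= 1, because W W^T = 1 - M^T M and
   W + W^T = 2. *)
Require Import Defs.
From HB Require Import structures.
From mathcomp Require Import all_boot all_order all_algebra.
From mathcomp Require Import complex mxtens reals.
From mathcomp Require Import ring.

Set Implicit Arguments.
Unset Strict Implicit.
Unset Printing Implicit Defensive.

Import Order.TTheory GRing.Theory Num.Theory.
Local Open Scope ring_scope.
Local Open Scope sesquilinear_scope.

(** * Grassmann calculus *)

(** The obstacle is a clash of signs: theta and eta anticommute, whereas the two factors of the
    ungraded tensor product commute. The fermion parity P bridges it. Put on both blocks of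
    generators it makes them anticommute, and since E commutes with conjugation by P, it surfaces in
    every relation only as one common left factor [P *t 1]. The same symmetry makes J even: the
    functional vanishes on words of odd length, so Wick's rule needs an argument only for words of
    even length. M enters only through W, and what sufficiency takes from W >= 0 is a factorization
    W = V^* V, which exists for singular W as well; so J is never written as an exponential of a
    quadratic form, and M is never brought to a normal form. The prefactor C is tied to J by tr J =
    2^n C. This comes from the constant term of the integral for X = 1: the eta's produced by the
    mu-integration already saturate the eta-integral, so M drops out. *)

Section GrassmannCalculus.
Variables (K : fieldType) (N : nat).
Implicit Types (a b z v w : 'I_N) (S T : {set 'I_N}) (s : seq 'I_N) (f g : grassmann K N).

Lemma gscaleE (k : K) f S : (k *: f) S = k * f S.
Proof. by rewrite ffunE. Qed.

Lemma gaddE f g S : (f + g) S = f S + g S.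
Proof. by rewrite ffunE. Qed.

Lemma grassmann_ind (P : grassmann K N -> Prop) :
  P 0 -> (forall k f g, P f -> P g -> P (k *: f + g)) ->
  P 1 -> (forall a f, P f -> P (gvar K a * f)) -> forall f, P f.
Proof.
move=> P0 PD P1 PM f; rewrite [f]grassmann_decomp.
apply: big_rec => // S g _ Pg; apply: PD => //.
rewrite /gmon; elim: (enum S) => [|a s IH]; first by rewrite big_nil.
by rewrite big_cons; apply: PM.
Qed.

Lemma gderiv_is_linear a : linear (@gderiv K N a).
Proof.
move=> k f g; apply/ffunP => S; rewrite !ffunE.
case: ifP => _; last by rewrite mulrDr; congr (_ + _); rewrite [LHS]mulrCA.
by rewrite [X in _ = X + _]mulr0 addr0.
Qed.
HB.instance Definition _ a := GRing.isLinear.Build K (grassmann K N)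
  (grassmann K N) *:%R (@gderiv K N a) (gderiv_is_linear a).

Lemma berezin_is_linear s : linear (@berezin K N s).
Proof.
move=> k; rewrite /berezin; elim: s => [//|a s IH] f g /=.
by rewrite linearP IH.
Qed.
HB.instance Definition _ s := GRing.isLinear.Build K (grassmann K N)
  (grassmann K N) *:%R (@berezin K N s) (berezin_is_linear s).

Definition gparity f : grassmann K N :=
  [ffun S : {set 'I_N} => (-1) ^+ #|S| * f S].

Lemma gparity_is_linear : linear gparity.
Proof.
move=> k f g; apply/ffunP => S; rewrite !ffunE mulrDr.
by congr (_ + _); rewrite [LHS]mulrCA.
Qed.
HB.instance Definition _ := GRing.isLinear.Build K (grassmann K N)
  (grassmann K N) *:%R gparity gparity_is_linear.

Lemma gparityK : involutive gparity.
Proof.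
move=> f; apply/ffunP => S.
by rewrite !ffunE mulrA -exprD addnn -signr_odd odd_double mul1r.
Qed.

Lemma gparityM f g : gparity (f * g) = gparity f * gparity g.
Proof.
apply/ffunP => S; rewrite !ffunE mulr_sumr; apply: eq_bigr => T TS.
by rewrite !ffunE -(cardsID T S) (setIidPr TS) exprD mulrCA [in RHS]mulrACA.
Qed.

Lemma gparity1 : gparity 1 = 1.
Proof.
apply/ffunP => S; rewrite !ffunE.
by case: eqP => [->|_]; rewrite ?cards0 ?mulr1 ?mulr0.
Qed.

Lemma gparity_gvar a : gparity (gvar K a) = - gvar K a.
Proof.
apply/ffunP => S; rewrite !ffunE.
by case: eqP => [->|_]; rewrite ?cards1 ?mulr1 ?mulr0 ?oppr0.
Qed.

Lemma gderivD1 a f g : gderiv a (f * g) = gderiv a f * g + gparity f * gderiv a g.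
Proof.
elim/grassmann_ind: f => [|k f h IHf IHh||b f IH].
- by rewrite mul0r !linear0 !mul0r addr0.
- rewrite mulrDl -scalerAl !linearP /= IHf IHh !mulrDl -!scalerAl !scalerDr.
  by rewrite addrACA.
- by rewrite mul1r gderiv1 mul0r add0r gparity1 mul1r.
rewrite -mulrA !gderivM IH gparityM gparity_gvar mulrDr mulrBl -scalerAl.
by rewrite !mulrA mulNr opprD addrA mulNr.
Qed.

Lemma gderiv_gparity a f : gderiv a (gparity f) = - gparity (gderiv a f).
Proof.
elim/grassmann_ind: f => [|k f h IHf IHh||b f IH].
- by rewrite !linear0.
- by rewrite !linearP /= IHf IHh.
- by rewrite gparity1 gderiv1 !linear0.
rewrite gparityM gparity_gvar mulNr linearN /= !gderivM IH [gparity (_ - _)]linearB /=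
  [gparity (_ *: _)]linearZ /=.
by rewrite gparityM gparity_gvar mulrN mulNr.
Qed.

Lemma gderiv_anticomm a b f : gderiv a (gderiv b f) = - gderiv b (gderiv a f).
Proof.
elim/grassmann_ind: f => [|k f h IHf IHh||c f IH].
- by rewrite !linear0.
- by rewrite !linearP /= IHf IHh.
- by rewrite !gderiv1 !linear0.
rewrite !gderivM ![gderiv _ (_ - _)]linearB /= ![gderiv _ (_ *: _)]linearZ /=.
by rewrite !gderivM IH mulrN opprK opprD addrA opprB addrAC.
Qed.

Lemma gderiv_sqr a f : gderiv a (gderiv a f) = 0.
Proof.
elim/grassmann_ind: f => [|k f h IHf IHh||c f IH].
- by rewrite !linear0.
- by rewrite !linearP /= IHf IHh scaler0 addr0.
- by rewrite !gderiv1 linear0.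
by rewrite gderivM linearB linearZ /= gderivM IH mulr0 subr0 subrr.
Qed.

Lemma gvar_parityC a f : f * gvar K a = gvar K a * gparity f.
Proof.
elim/grassmann_ind: f => [|k f h IHf IHh||c f IH].
- by rewrite linear0 mul0r mulr0.
- by rewrite linearP /= mulrDl mulrDr -scalerAl IHf IHh scalerAr.
- by rewrite gparity1 mul1r mulr1.
by rewrite -mulrA IH gparityM gparity_gvar !mulrA gvar_anticomm mulrN.
Qed.

Lemma geven_central f g : gparity f = f -> f * g = g * f.
Proof.
move=> ef; elim/grassmann_ind: g => [|k g h IHg IHh||c g IH].
- by rewrite mul0r mulr0.
- by rewrite mulrDr mulrDl -scalerAr IHg IHh scalerAl.
- by rewrite mul1r mulr1.
by rewrite mulrA gvar_parityC ef -!mulrA IH.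
Qed.

Lemma gparityX f k : gparity f = f -> gparity (f ^+ k) = f ^+ k.
Proof.
by move=> ef; elim: k => [|k IH]; rewrite ?expr0 ?gparity1 // exprS gparityM ef IH.
Qed.

Lemma gparity_gexp f : gparity f = f -> gparity (gexp f) = gexp f.
Proof.
move=> ef; rewrite /gexp linear_sum; apply: eq_bigr => k _.
by rewrite linearZ /= gparityX.
Qed.

Lemma gderivX a f k : gparity f = f ->
  gderiv a (f ^+ k.+1) = k.+1%:R *: (gderiv a f * f ^+ k).
Proof.
move=> ef; elim: k => [|k IH]; first by rewrite expr1 expr0 mulr1 scale1r.
rewrite exprS gderivD1 ef IH -scalerAr mulrA (geven_central _ ef) -mulrA -exprS.
by rewrite [k.+2%:R]mulrS scalerDl scale1r.
Qed.

Lemma gderiv_gexp a f : [pchar K] =i pred0 -> gparity f = f -> f set0 = 0 ->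
  gderiv a (gexp f) = gderiv a f * gexp f.
Proof.
move=> /pcharf0P K0 ef f0.
have nz k : (k.+1%:R : K) != 0 by rewrite K0.
have nzf k : (k`!%:R : K) != 0 by rewrite K0 -lt0n fact_gt0.
rewrite /gexp linear_sum big_ord_recl /= fact0 invr1 scale1r expr0 gderiv1 add0r.
rewrite big_ord_recr /= mulrDr -scalerAr.
(* Differentiating the truncated series loses the term of degree N. That term vanishes, since N+1
   times it is the derivative of f^(N+1) = 0; characteristic zero is used to divide. *)
have -> : gderiv a f * f ^+ N = 0.
  apply: (scalerI (nz N)); rewrite scaler0 -gderivX // gexp_trunc //.
  by rewrite linear0.
rewrite scaler0 addr0 mulr_sumr; apply: eq_bigr => k _.
rewrite linearZ /= gderivX // -scalerAr scalerA /bump add1n factS.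
by rewrite natrM invfM mulrAC mulVf ?mul1r.
Qed.

Lemma berezin_gderiv s a f :
  berezin s (gderiv a f) = (-1) ^+ size s *: gderiv a (berezin s f).
Proof.
elim: s f => [|b s IH] f /=; first by rewrite expr0 scale1r.
rewrite /berezin /= -/(berezin _ _) gderiv_anticomm linearN /= IH exprS mulN1r.
by rewrite scaleNr.
Qed.

Lemma berezin_gderiv0 s a f : a \in s -> berezin s (gderiv a f) = 0.
Proof.
elim: s f => [//|b s IH] f; rewrite inE => /orP[/eqP <-|/IH as0].
  by rewrite /berezin /= -/(berezin _ _) gderiv_sqr linear0.
by rewrite /berezin /= -/(berezin _ _) gderiv_anticomm linearN /= as0 oppr0.
Qed.

Lemma berezin_gvar s a f : a \notin s ->
  berezin s (gvar K a * f) = (-1) ^+ size s *: (gvar K a * berezin s f).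
Proof.
elim: s f => [|b s IH] f /=; first by rewrite expr0 scale1r.
rewrite inE negb_or eq_sym => /andP[/negPf ba nas].
rewrite /berezin /= -/(berezin _ _) gderivM ba scale0r sub0r linearN /= IH //.
by rewrite exprS mulN1r scaleNr.
Qed.

Lemma berezin_gparity s f :
  berezin s (gparity f) = (-1) ^+ size s *: gparity (berezin s f).
Proof.
elim: s f => [|b s IH] f /=; first by rewrite expr0 scale1r.
rewrite /berezin /= -/(berezin _ _) gderiv_gparity linearN /= IH.
by rewrite exprS mulN1r scaleNr.
Qed.

(** Each derivative strips its own generator. The other term of the Leibniz rule keeps that
    generator in front through the remaining integrals, so it has no constant term. *)
Lemma berezin_prodM s f : uniq s ->
  berezin s ((\prod_(a <- s) gvar K a) * f) set0 = f set0.
Proof.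
elim: s f => [|a s IH] f /=; first by rewrite big_nil mul1r.
case/andP=> nas /IH IHs.
rewrite big_cons /berezin /= -/(berezin _ _) -mulrA gderivM eqxx scale1r.
rewrite linearB /= [LHS]ffunE IHs berezin_gvar //.
by rewrite [X in _ + X]ffunE gscaleE gvarM inE mulr0 oppr0 addr0.
Qed.

Lemma gderiv_gvar z w : gderiv z (gvar K w) = (z == w)%:R.
Proof. by rewrite -[gvar K w]mulr1 gderivM gderiv1 mulr0 subr0 scaler_nat. Qed.

Lemma gderiv_gvar2 z v w :
  gderiv z (gvar K v * gvar K w) = (z == v)%:R *: gvar K w - (z == w)%:R *: gvar K v.
Proof. by rewrite gderivM gderiv_gvar mulr_natr scaler_nat [in RHS]scaler_nat. Qed.

Lemma gvar2_set0 z w : (gvar K z * gvar K w) set0 = 0.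
Proof. by rewrite gvarM inE. Qed.

Lemma gparity_gvar2 z w :
  gparity (gvar K z * gvar K w) = gvar K z * gvar K w.
Proof. by rewrite gparityM !gparity_gvar mulrNN. Qed.

Lemma gparity_prod s :
  gparity (\prod_(z <- s) gvar K z) = (-1) ^+ size s *: \prod_(z <- s) gvar K z.
Proof.
elim: s => [|b s IH]; first by rewrite !big_nil scale1r gparity1.
by rewrite !big_cons gparityM gparity_gvar IH /= exprS mulN1r scaleNr -scalerAr mulNr scalerN.
Qed.

Lemma gmul_set0 f g : (f * g) set0 = f set0 * g set0.
Proof.
rewrite ffunE (bigD1 set0) ?sub0set //= gsign0l setDv mul1r big1 ?addr0 // => T.
by rewrite subset0 => /andP[/eqP ->]; rewrite eqxx.
Qed.

Lemma gexp_set0 f : f set0 = 0 -> gexp f set0 = 1.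
Proof.
move=> f0; rewrite /gexp sum_ffunE big_ord_recl big1 => [|k _].
  by rewrite gscaleE expr0 fact0 invr1 mul1r ffunE eqxx addr0.
by rewrite gscaleE exprS gmul_set0 f0 mul0r mulr0.
Qed.

End GrassmannCalculus.

(** * Reordering of products of anticommuting elements *)

Section SortedProducts.
Variable m : nat.
Implicit Types (a b : 'I_m) (S : {set 'I_m}).

Lemma enum_set_sorted S : sorted (fun a b : 'I_m => (a < b)%N) (enum S).
Proof.
rewrite /enum_mem sorted_filter //; first by move=> ? ? ?; apply: ltn_trans.
by have := iota_ltn_sorted 0 m; rewrite -val_enum_ord sorted_map enumT.
Qed.

Lemma sorted_enum_set (s : seq 'I_m) S :
  sorted (fun a b : 'I_m => (a < b)%N) s -> s =i S -> s = enum S.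
Proof.
move=> ss sS; apply: irr_sorted_eq ss (enum_set_sorted S) _.
- by move=> ? ? ?; apply: ltn_trans.
- by move=> ?; apply: ltnn.
by move=> x; rewrite mem_enum sS.
Qed.

(** Moving [v a] past the letters below [a] brings it to its place in increasing order, one sign per
    letter. The ring is arbitrary because the rule serves Grassmann generators, substituted
    variables and Clifford generators alike. *)
Lemma anticomm_prod_insert (A : pzRingType) (v : 'I_m -> A) a S :
    (forall a b, a != b -> v a * v b = - (v b * v a)) -> a \notin S ->
  v a * \prod_(b <- enum S) v b =
    (-1) ^+ (\sum_(b in S) (b < a)%N) * \prod_(b <- enum (a |: S)) v b.
Proof.
move=> vA aS.
pose s1 := [seq b : 'I_m <- enum S | (b < a)%N]; pose s2 := [seq b : 'I_m <- enum S | (a < b)%N].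
have tr : transitive (fun a b : 'I_m => (a < b)%N) by move=> ? ? ?; apply: ltn_trans.
have m1 x : (x \in s1) = (x < a)%N && (x \in S) by rewrite mem_filter mem_enum.
have m2 x : (x \in s2) = (a < x)%N && (x \in S) by rewrite mem_filter mem_enum.
have so1 : sorted (fun a b : 'I_m => (a < b)%N) s1.
  by apply: sorted_filter (enum_set_sorted S).
have so2 : sorted (fun a b : 'I_m => (a < b)%N) s2.
  by apply: sorted_filter (enum_set_sorted S).
have defS : s1 ++ s2 = enum S.
  apply: sorted_enum_set; last first.
    move=> x; rewrite mem_cat m1 m2 -andb_orl -neq_ltn.
    by case: (eqVneq (x : nat) a) => [/val_inj ->|//]; rewrite (negPf aS).
  rewrite sorted_pairwise // pairwise_cat -!sorted_pairwise // so1 so2 !andbT.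
  apply/allrelP => x y; rewrite m1 m2 => /andP[xa _] /andP[ay _].
  exact: ltn_trans ay.
have defaS : s1 ++ a :: s2 = enum (a |: S).
  apply: sorted_enum_set; last first.
    move=> x; rewrite mem_cat !inE orbCA -mem_cat defS mem_enum //.
  rewrite sorted_pairwise // pairwise_cat pairwise_cons -!sorted_pairwise //.
  rewrite so1 so2 !andbT; apply/andP; split.
    apply/allrelP => x y; rewrite m1 inE => /andP[xa _].
    case/orP=> [/eqP -> //|]; rewrite m2 => /andP[ay _].
    exact: ltn_trans ay.
  by apply/allP => x; rewrite m2 => /andP[].
have -> : (\sum_(b in S) (b < a)%N)%N = size s1.
  rewrite size_filter -sum1_count big_enum_cond /= [RHS]big_mkcondr /=.
  by apply: eq_bigr => b _; case: (b < a)%N.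
rewrite -defS -defaS !big_cat big_cons /= mulrA [RHS]mulrA.
rewrite [in RHS]mulrA; congr (_ * _).
have : a \notin s1 by rewrite m1 ltnn.
elim: s1 {m1 so1 defS defaS} => [|b s IH]; first by rewrite !big_nil !mul1r mulr1.
rewrite inE negb_or => /andP[ab /IH IHs]; rewrite !big_cons mulrA vA //.
rewrite mulNr -mulrA IHs /= exprS mulN1r !mulNr !mulrA.
by rewrite (commrX (size s) (commrN1 (v b))).
Qed.

End SortedProducts.

(** * Substitution of Grassmann variables *)

Section Substitution.
Variables (K : fieldType) (m N : nat).
Implicit Types S : {set 'I_m}.

Lemma gsign1_sum (a : 'I_m) S :
  gsign K [set a] S = (-1) ^+ (\sum_(b in S) (b < a)%N).
Proof. by rewrite gsign1E expr_sum. Qed.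

Lemma signr_scale (A : lalgType K) (k : nat) (x : A) : (-1) ^+ k * x = (-1) ^+ k *: x.
Proof. by rewrite -signr_odd -[in RHS]signr_odd mulr_sign scaler_sign. Qed.

Lemma gvar_gmon (a : 'I_m) S : a \notin S ->
  gvar K a * gmon K S = gsign K [set a] S *: gmon K (a |: S).
Proof.
move=> aS; rewrite /gmon (anticomm_prod_insert _ aS) ?signr_scale ?gsign1_sum //.
by move=> *; apply: gvar_anticomm.
Qed.

Section Morphism.
Variable v : 'I_m -> grassmann K N.
Hypotheses (v_anticomm : forall a b, a != b -> v a * v b = - (v b * v a)).
Hypothesis (v_sqr : forall a, v a * v a = 0).

Lemma gsubst_is_linear : linear (gsubst v).
Proof.
move=> k f g; rewrite /gsubst scaler_sumr -big_split /=; apply: eq_bigr => S _.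
by rewrite gaddE gscaleE scalerDl scalerA.
Qed.
HB.instance Definition _ := GRing.isLinear.Build K (grassmann K m)
  (grassmann K N) *:%R (gsubst v) gsubst_is_linear.

Lemma gsubst_gmon S : gsubst v (gmon K S) = \prod_(a <- enum S) v a.
Proof.
rewrite /gsubst (bigD1 S) //= gmonE eqxx scale1r [X in _ + X]big1 ?addr0 // => T /negPf nTS.
by rewrite gmonE nTS scale0r.
Qed.

Lemma gsubst1 : gsubst v 1 = 1.
Proof.
have <- : gmon K (set0 : {set 'I_m}) = 1 by rewrite /gmon enum_set0 big_nil.
by rewrite gsubst_gmon enum_set0 big_nil.
Qed.

Lemma gsubst_gvarM a f : gsubst v (gvar K a * f) = v a * gsubst v f.
Proof.
rewrite [f]grassmann_decomp mulr_sumr !linear_sum mulr_sumr; apply: eq_bigr => S _.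
rewrite -scalerAr !linearZ /= -scalerAr; congr (_ *: _).
have ins (T : {set 'I_m}) : a \notin T ->
    gsubst v (gvar K a * gmon K T) = v a * gsubst v (gmon K T).
  move=> aT; rewrite gvar_gmon // linearZ /= !gsubst_gmon.
  by rewrite (anticomm_prod_insert v_anticomm aT) signr_scale gsign1_sum.
have [aS|/ins//] := boolP (a \in S).
(* With [a] in S, the monomial of S is, up to an invertible sign, the generator [a] times the
   monomial of S without [a]; both sides then contain a square and vanish. *)
have nas : a \notin S :\ a by rewrite !inE eqxx.
have := gvar_gmon nas; rewrite setD1K // => defS.
have gg : gsign K [set a] (S :\ a) != 0.
  apply/eqP => g0; have := gsign1_sqr K a (S :\ a); rewrite g0 mul0r.
  by move/eqP; rewrite eq_sym oner_eq0.
apply: (scalerI gg); rewrite -linearZ /= scalerAr -defS mulrA gvar_sqr mul0r.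
rewrite linear0 scalerAr -linearZ /= -defS ins // mulrA v_sqr.
by rewrite mul0r.
Qed.

End Morphism.

Variable iota : 'I_m -> 'I_N.
Hypothesis iota_mono : {mono iota : a b / (a < b)%N}.
Let v a := gvar K (iota a).

Lemma mono_ltn_inj : injective iota.
Proof.
move=> a b e; apply: val_inj.
by case: (ltngtP (a : nat) b) => //; rewrite -iota_mono e ltnn.
Qed.

Lemma gsubst_gvar_gvarM a f :
  gsubst v (gvar K a * f) = v a * gsubst v f.
Proof.
apply: gsubst_gvarM => *; [exact: gvar_anticomm|exact: gvar_sqr].
Qed.

Lemma gsubst_gderiv a f : gderiv (iota a) (gsubst v f) = gsubst v (gderiv a f).
Proof.
elim/grassmann_ind: f => [|k f h IHf IHh||b f IH].
- by rewrite !linear0.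
- by rewrite !linearP /= IHf IHh.
- by rewrite gsubst1 !gderiv1 linear0.
rewrite gsubst_gvar_gvarM !gderivM IH linearB linearZ /= gsubst_gvar_gvarM.
by rewrite (inj_eq mono_ltn_inj).
Qed.

Lemma gsubst_gderiv0 z f : (forall a, iota a != z) -> gderiv z (gsubst v f) = 0.
Proof.
move=> nz; elim/grassmann_ind: f => [|k f h IHf IHh||b f IH].
- by rewrite !linear0.
- by rewrite !linearP /= IHf IHh scaler0 addr0.
- by rewrite gsubst1 gderiv1.
by rewrite gsubst_gvar_gvarM gderivM IH eq_sym (negPf (nz b)) scale0r mulr0 subr0.
Qed.

Lemma gsubst_gparity f : gparity (gsubst v f) = gsubst v (gparity f).
Proof.
elim/grassmann_ind: f => [|k f h IHf IHh||b f IH].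
- by rewrite !linear0.
- by rewrite !linearP /= IHf IHh.
- by rewrite gsubst1 !gparity1 gsubst1.
rewrite gsubst_gvar_gvarM !gparityM IH !gparity_gvar mulNr.
by rewrite -gsubst_gvar_gvarM -linearN mulNr.
Qed.

(** An order-preserving renaming sends increasing products to increasing products, so no sign
    appears. This is what makes the substitution injective. *)
Lemma gsubst_coef f S : gsubst v f (iota @: S) = f S.
Proof.
have prodE (T : {set 'I_m}) : \prod_(a <- enum T) v a = gmon K (iota @: T).
  rewrite /gmon -(sorted_enum_set (s := map iota (enum T))) ?big_map //.
    have := enum_set_sorted T.
    by rewrite sorted_map; apply: sub_sorted => a b /=; rewrite iota_mono.
  by move=> x; apply/mapP/imsetP => -[a]; rewrite ?mem_enum => aT ->; exists a; rewrite ?mem_enum.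
rewrite /gsubst sum_ffunE (bigD1 S) //= gscaleE prodE gmonE eqxx mulr1.
rewrite big1 ?addr0 // => T /negPf nTS; rewrite gscaleE prodE gmonE.
by rewrite (inj_eq (imset_inj mono_ltn_inj)) eq_sym nTS mulr0.
Qed.

Lemma gsubst_inj : injective (gsubst v).
Proof. by move=> f g e; apply/ffunP => S; rewrite -!gsubst_coef e. Qed.

End Substitution.

(** * Clifford multiplication in the Grassmann representation *)

Section CliffordMultiplication.
Variables (K : numClosedFieldType) (n : nat).
Variable c : 'I_(2 * n) -> 'M[K]_(2 ^ n).
Hypothesis cP : clifford_generators c.
Implicit Types (S : {set 'I_(2 * n)}) (X : 'M[K]_(2 ^ n)).
Local Notation rep := (grassmann_rep c).

Lemma trmxC_scale p q (k : K) (A : 'M[K]_(p, q)) : (k *: A)^t* = k^* *: A^t*.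
Proof. by apply/matrixP => i j; rewrite !mxE rmorphM. Qed.

Lemma sign_scale_mx p k (A : 'M[K]_p) : (-1) ^+ k *m A = (-1) ^+ k *: A.
Proof.
rewrite -signr_odd -[in RHS]signr_odd mulmxE; case: (odd k).
  by rewrite !expr1 mulN1r scaleN1r.
by rewrite !expr0 mul1r scale1r.
Qed.

Lemma cmon_insert a S : a \notin S ->
  c a *m cmon c S = gsign K [set a] S *: cmon c (a |: S).
Proof.
move=> aS; rewrite /cmon mulmxE (anticomm_prod_insert _ aS); last first.
  by move=> *; apply: (generator_anticomm cP).
by rewrite -mulmxE sign_scale_mx gsign1_sum.
Qed.

Lemma generator_cmonE a S : c a *m cmon c S =
  if a \in S then gsign K [set a] (S :\ a) *: cmon c (S :\ a)
  else gsign K [set a] S *: cmon c (a |: S).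
Proof.
case: (boolP (a \in S)) => [aS|]; last exact: cmon_insert.
have := @cmon_insert a (S :\ a); rewrite !inE eqxx setD1K // => /(_ isT).
move=> /(congr1 (fun Y => gsign K [set a] (S :\ a) *: (c a *m Y))).
rewrite -!scalemxAr scalerA gsign1_sqr scale1r => <-.
by rewrite mulmxA (generator_sqr cP) mul1mx.
Qed.

Lemma grassmann_repE X S : rep X S = (2 ^ n)%:R^-1 * \tr ((cmon c S)^t* *m X).
Proof. by rewrite ffunE. Qed.

Lemma gsign1_conj (N : nat) (a : 'I_N) (S : {set 'I_N}) : (gsign K [set a] S)^* = gsign K [set a] S.
Proof. by rewrite gsign1_sum rmorphXn rmorphN1. Qed.

(** The Clifford action on the exterior algebra. Moved across the trace onto [cmon c S], the
    Hermitian generator either inserts or deletes the letter [a]. *)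
Lemma grassmann_rep_mull a X :
  rep (c a *m X) = gvar K a * rep X + gderiv a (rep X).
Proof.
apply/ffunP => S; rewrite gaddE gvarM [gderiv _ _ S]ffunE !grassmann_repE.
rewrite mulmxA -{1}(cP.1 a) -trmxC_mul generator_cmonE.
case: ifP => _; rewrite trmxC_scale gsign1_conj -scalemxAl mxtraceZ;
  by rewrite ?addr0 ?add0r mulrCA.
Qed.

(** By cyclicity of the trace, right multiplication differs from left multiplication, coefficient by
    coefficient, only by the sign of commuting [c a] with [cmon c S]. *)
Lemma grassmann_rep_mulr a X :
  rep (X *m c a) = gvar K a * gparity (rep X) - gderiv a (gparity (rep X)).
Proof.
apply/ffunP => S.
have -> : rep (X *m c a) S = (-1) ^+ (#|S| + (a \in S)) * rep (c a *m X) S.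
  rewrite !grassmann_repE mulmxA mxtrace_mulC !mulmxA -{1}(cP.1 a) -trmxC_mul.
  have -> : cmon c S *m c a = (-1) ^+ (#|S| + (a \in S)) *: (c a *m cmon c S).
    rewrite (generator_cmon cP) scalerA -exprD addnn -signr_odd odd_double.
    by rewrite expr0 scale1r.
  rewrite trmxC_scale rmorphXn rmorphN1 -scalemxAl mxtraceZ mulrCA.
  by rewrite trmxC_mul cP.1.
rewrite grassmann_rep_mull gaddE [RHS]gaddE [X in _ = _ + X]ffunE.
rewrite !gvarM ![gderiv _ _ S]ffunE ![gparity _ _]ffunE.
case: (boolP (a \in S)) => aS.
  rewrite addr0 oppr0 addr0 (cardsD1 a S) aS /= add1n addn1 !exprS !mulN1r.
  by rewrite opprK mulrCA.
by rewrite !add0r cardsU1 aS addn0 add1n exprS mulN1r mulNr mulrN opprK mulrCA.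
Qed.

Lemma prod_generators_adj (s : seq 'I_(2 * n)) : uniq s ->
  exists k, (\prod_(a <- s) c a)^t* = (-1) ^+ k *: \prod_(a <- s) c a.
Proof.
elim: s => [|a s IH] /=.
  by exists 0; rewrite big_nil expr0 scale1r trmx1 map_mx1.
case/andP => nas /IH[k ek]; exists (size s + k)%N.
rewrite big_cons -mulmxE trmxC_mul cP.1 ek -scalemxAl exprD [_ ^+ _ * _]mulrC.
rewrite -scalerA; congr (_ *: _).
elim: s nas {IH ek} => [_|b s IH]; first by rewrite big_nil expr0 scale1r mul1mx mulmx1.
rewrite inE negb_or => /andP[ab /IH IHs].
rewrite big_cons -mulmxE -mulmxA IHs -scalemxAr !mulmxA.
rewrite /= exprS mulrC -scalerA; congr (_ *: _).
by rewrite scaleN1r (generator_anticomm cP ab) mulNmx opprK.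
Qed.

(** The fermion parity: conjugation by it is the grading [gparity]. The last clause serves
    [in_span_parity], where P has to be written in the generators. *)
Definition parity_operator (P : 'M[K]_(2 ^ n)) :=
  [/\ P^t* = P, P *m P = 1%:M, forall a, P *m c a = - (c a *m P)
    & exists z, P = z *: cmon c setT].

Lemma parity_operator_exists : exists P, parity_operator P.
Proof.
have [k ek] := prod_generators_adj (enum_uniq [set: 'I_(2 * n)]).
pose P0 := cmon c setT; have {}ek : P0^t* = (-1) ^+ k *: P0 by [].
have P0P0 : P0^t* *m P0 = 1%:M by apply: cmon_unitary.
have P0A a : P0 *m c a = - (c a *m P0).
  rewrite generator_cmon // in_setT cardsT card_ord -signr_odd oddD oddM /=.
  by rewrite expr1 scaleN1r opprK.
(* The full product is unitary and Hermitian or anti-Hermitian according to the parity of k; the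
   phase makes it Hermitian, hence an involution. *)
pose z : K := if odd k then 'i else 1.
exists (z *: P0); rewrite /parity_operator.
have adjz : (z *: P0)^t* = z *: P0.
  rewrite trmxC_scale ek scalerA -signr_odd /z; case: (odd k).
    by rewrite conjCi expr1 mulrN1 opprK.
  by rewrite rmorph1 mulr1.
split=> // [|a|]; last 2 first.
- by rewrite -scalemxAl P0A -scalemxAr scalerN.
- by exists z.
rewrite -{1}adjz trmxC_scale -scalemxAl -scalemxAr scalerA P0P0.
rewrite /z; case: (odd k); rewrite ?rmorph1 ?mulr1 ?scale1r // conjCi mulNr.
by rewrite -expr2 sqrCi opprK scale1r.
Qed.

Section Parity.
Variable P : 'M[K]_(2 ^ n).
Hypothesis hP : parity_operator P.

Lemma parity_cmon S : P *m cmon c S *m P = (-1) ^+ #|S| *: cmon c S.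
Proof.
case: hP => _ PP PA _; rewrite /cmon cardE; elim: (enum S) => [|a s IH].
  by rewrite big_nil expr0 scale1r mulmx1.
rewrite big_cons -mulmxE (mulmxA P) PA !mulNmx -!mulmxA (mulmxA P) IH.
by rewrite -scalemxAr exprS mulN1r scaleNr.
Qed.

Lemma grassmann_rep_parity X : rep (P *m X *m P) = gparity (rep X).
Proof.
apply/ffunP => S; rewrite [RHS]ffunE !grassmann_repE mulrCA; congr (_ * _).
have [Pad _ _ _] := hP.
rewrite mulmxA mxtrace_mulC !mulmxA.
have := congr1 (fun Y => Y^t*) (parity_cmon S).
rewrite trmxC_scale rmorphXn rmorphN1 !trmxC_mul Pad mulmxA => ->.
by rewrite -scalemxAl mxtraceZ.
Qed.

Definition cvar a X := 2^-1 *: (c a *m X + P *m X *m P *m c a).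
Definition cderiv a X := 2^-1 *: (c a *m X - P *m X *m P *m c a).

Lemma half_double (V : lmodType K) (x : V) : 2^-1 *: (x + x) = x.
Proof.
by rewrite -mulr2n -scaler_nat scalerA mulVf ?pnatr_eq0 // scale1r.
Qed.

(** Left multiplication by [c a] is theta_a + d_a, while right multiplication after the grading is
    theta_a - d_a; half the sum and half the difference separate the two. *)
Lemma grassmann_rep_cvar a X : rep (cvar a X) = gvar K a * rep X.
Proof.
rewrite linearZ linearD /= grassmann_rep_mull grassmann_rep_mulr.
by rewrite grassmann_rep_parity gparityK addrACA subrr addr0 half_double.
Qed.

Lemma grassmann_rep_cderiv a X : rep (cderiv a X) = gderiv a (rep X).
Proof.
rewrite linearZ linearB /= grassmann_rep_mull grassmann_rep_mulr.
rewrite grassmann_rep_parity gparityK opprB [X in _ + X]addrC.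
by rewrite addrACA subrr add0r half_double.
Qed.

End Parity.
End CliffordMultiplication.

(** * The Gaussian integral by parts *)

Section GaussianIntegral.
Variables (K : numClosedFieldType) (n : nat).
Local Notation m := (2 * n)%N.
Local Notation G := (grassmann K (m + m + m)).
(* HB.structures exports another eta. *)
Local Notation eta := Defs.eta.
Variable M : 'M[K]_(m + m).
Hypothesis Manti : M^T = - M.
Implicit Types (a b : 'I_m) (f g : G).

Definition theta_eta_ix (j : 'I_(m + m)) : 'I_(m + m + m) := lshift _ j.

Lemma theta_etaE j : theta_eta K j = gvar K (theta_eta_ix j).
Proof.
rewrite /theta_eta -{2}(splitK j) /theta /eta /theta_ix /eta_ix.
by case: (split j).
Qed.

Lemma theta_eta_l a : theta_eta K (lshift m a) = theta K a.
Proof. by rewrite /theta_eta (unsplitK (inl a)). Qed.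

Lemma theta_eta_r a : theta_eta K (rshift m a) = eta K a.
Proof. by rewrite /theta_eta (unsplitK (inr a)). Qed.

Lemma eta_ixE a : eta_ix a = theta_eta_ix (rshift _ a). Proof. by []. Qed.
Lemma theta_ixE a : theta_ix a = theta_eta_ix (lshift _ a). Proof. by []. Qed.

Lemma theta_eta_ix_inj : injective theta_eta_ix.
Proof. exact: lshift_inj. Qed.

Lemma eta_ix_inj : injective (@eta_ix n).
Proof. by move=> a b /theta_eta_ix_inj/rshift_inj. Qed.

Lemma mu_ix_inj : injective (@mu_ix n).
Proof. exact: rshift_inj. Qed.

Lemma mu_theta_eta a j : (mu_ix a == theta_eta_ix j) = false.
Proof. by rewrite /mu_ix /theta_eta_ix eq_rlshift. Qed.

Lemma theta_eta_mu a j : (theta_eta_ix j == mu_ix a) = false.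
Proof. by rewrite eq_sym mu_theta_eta. Qed.

Lemma gderiv_lagrangian_mu a : gderiv (mu_ix a) (lagrangian M) = 0.
Proof.
rewrite /lagrangian /gbilin linearZ linear_sum /= big1 ?scaler0 // => i _.
rewrite linear_sum big1 // => j _ /=; rewrite linearZ /= !theta_etaE gderiv_gvar2.
by rewrite !mu_theta_eta !scale0r subr0 scaler0.
Qed.

Lemma gderiv_lagrangian j :
  gderiv (theta_eta_ix j) (lagrangian M) = 'i *: \sum_k M j k *: theta_eta K k.
Proof.
rewrite /lagrangian /gbilin linearZ linear_sum /=.
have -> : \sum_i gderiv (theta_eta_ix j) (\sum_k M i k *: (theta_eta K i * theta_eta K k))
   = 2 *: \sum_k M j k *: theta_eta K k.
  transitivity (\sum_i \sum_k ((i == j)%:R *: (M i k *: theta_eta K k)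
                   - (k == j)%:R *: (M i k *: theta_eta K i))).
    apply: eq_bigr => i _; rewrite linear_sum; apply: eq_bigr => k _.
    rewrite linearZ /= !theta_etaE gderiv_gvar2 !(inj_eq theta_eta_ix_inj).
    rewrite ![j == _]eq_sym scalerBr !scalerA.
    by rewrite [_ * (i == j)%:R]mulrC [_ * (k == j)%:R]mulrC.
  under eq_bigr do rewrite big_split /=.
  rewrite big_split /= scaler_nat mulr2n; congr (_ + _).
    rewrite (bigD1 j) //= [X in _ + X]big1 ?addr0; last first.
      by move=> i /negPf ->; rewrite big1 // => k _; rewrite scale0r.
    by apply: eq_bigr => k _; rewrite eqxx scale1r.
  apply: eq_bigr => i _; rewrite (bigD1 j) //= eqxx scale1r big1 ?addr0.
    have /matrixP/(_ i j) := Manti; rewrite !mxE => ->.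
    by rewrite scaleNr.
  by move=> k /negPf ->; rewrite scale0r oppr0.
by rewrite scalerA divfK ?pnatr_eq0.
Qed.

Lemma gderiv_eta_mu_mu a : gderiv (mu_ix a) (eta_mu K n) = - eta K a.
Proof.
rewrite /eta_mu linear_sum (bigD1 a) //= big1 ?addr0 => [|b /negPf ba].
  by rewrite gderiv_gvar2 eqxx scale1r eta_ixE mu_theta_eta scale0r sub0r.
rewrite gderiv_gvar2 eta_ixE mu_theta_eta (inj_eq mu_ix_inj) eq_sym ba.
by rewrite !scale0r subr0.
Qed.

Lemma gderiv_eta_mu_eta a : gderiv (eta_ix a) (eta_mu K n) = mu K a.
Proof.
rewrite /eta_mu linear_sum (bigD1 a) //= big1 ?addr0 => [|b /negPf ba].
  by rewrite gderiv_gvar2 eqxx scale1r eta_ixE theta_eta_mu scale0r subr0.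
rewrite gderiv_gvar2 {2}eta_ixE theta_eta_mu (inj_eq eta_ix_inj) eq_sym ba.
by rewrite !scale0r subr0.
Qed.

Lemma gderiv_eta_mu_theta a : gderiv (theta_ix a) (eta_mu K n) = 0.
Proof.
rewrite /eta_mu linear_sum big1 // => b _ /=.
rewrite gderiv_gvar2 eta_ixE !theta_ixE theta_eta_mu (inj_eq theta_eta_ix_inj).
by rewrite eq_lrshift !scale0r subr0.
Qed.

Definition action : G := lagrangian M + 'i *: eta_mu K n.
Local Notation e := (gexp action).

Lemma gderiv_action_mu a : gderiv (mu_ix a) action = - 'i *: eta K a.
Proof.
rewrite linearD /= gderiv_lagrangian_mu add0r linearZ /= gderiv_eta_mu_mu.
by rewrite scalerN scaleNr.
Qed.

Lemma gderiv_action_eta a : gderiv (eta_ix a) action =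
  'i *: ((\sum_k M (rshift _ a) k *: theta_eta K k) + mu K a).
Proof.
rewrite linearD /= {1}eta_ixE gderiv_lagrangian.
by rewrite [X in _ + X]linearZ /= gderiv_eta_mu_eta scalerDr.
Qed.

Lemma gderiv_action_theta a : gderiv (theta_ix a) action =
  'i *: \sum_k M (lshift _ a) k *: theta_eta K k.
Proof.
rewrite linearD /= {1}theta_ixE gderiv_lagrangian.
by rewrite [X in _ + X]linearZ /= gderiv_eta_mu_theta scaler0 addr0.
Qed.

Lemma action_set0 : action set0 = 0.
Proof.
rewrite /action /lagrangian /gbilin /eta_mu gaddE !gscaleE !sum_ffunE.
rewrite big1 ?[X in _ + _ * X]big1 ?mulr0 ?addr0 // => [b _|i _].
  exact: gvar2_set0.
rewrite sum_ffunE big1 // => k _.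
by rewrite gscaleE !theta_etaE gvar2_set0 mulr0.
Qed.

Lemma gparity_action : gparity action = action.
Proof.
rewrite /action /lagrangian /gbilin /eta_mu linearD !linearZ /=.
congr (_ *: _ + _ *: _); rewrite linear_sum; apply: eq_bigr => i _.
  rewrite linear_sum; apply: eq_bigr => k _.
  by rewrite linearZ /= !theta_etaE gparity_gvar2.
exact: gparity_gvar2.
Qed.

Lemma gderiv_exp_action z : gderiv z e = gderiv z action * e.
Proof.
apply: gderiv_gexp; [exact: pchar_num|exact: gparity_action|exact: action_set0].
Qed.

Lemma exp_action_central f : e * f = f * e.
Proof. by apply/geven_central/gparity_gexp/gparity_action. Qed.

Definition int_eta_mu f : G := int_eta (int_mu f).
Local Notation I := int_eta_mu.

Lemma int_eta_mu_is_linear : linear int_eta_mu.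
Proof. by move=> k f g; rewrite /int_eta_mu /int_eta /int_mu !linearP. Qed.
HB.instance Definition _ := GRing.isLinear.Build K G G *:%R int_eta_mu
  int_eta_mu_is_linear.

(** Each of the two Berezin integrals consists of 2n derivatives, so moving a derivative, a theta or
    the grading through them costs no sign. *)
Lemma signr_even (A : pzRingType) : (-1) ^+ (2 * n) = 1 :> A.
Proof. by rewrite exprM sqrrN expr1n expr1n. Qed.

Lemma size_map_enum (T : Type) (h : 'I_m -> T) : size [seq h a | a <- enum 'I_m] = m.
Proof. by rewrite size_map size_enum_ord. Qed.

Lemma int_gderiv_mu a f : I (gderiv (mu_ix a) f) = 0.
Proof.
by rewrite /I /int_mu /int_eta berezin_gderiv0 ?linear0 ?map_f ?mem_enum.
Qed.

Lemma int_gderiv z f : I (gderiv z f) = gderiv z (I f).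
Proof.
rewrite /I /int_mu /int_eta berezin_gderiv size_map_enum signr_even.
by rewrite scale1r berezin_gderiv size_map_enum signr_even scale1r.
Qed.

Lemma int_gderiv_eta a f : I (gderiv (eta_ix a) f) = 0.
Proof.
rewrite /I /int_mu berezin_gderiv size_map_enum signr_even scale1r.
by rewrite /int_eta berezin_gderiv0 ?map_f ?mem_enum.
Qed.

Lemma int_theta a f : I (theta K a * f) = theta K a * I f.
Proof.
rewrite /I /int_mu berezin_gvar ?size_map_enum ?signr_even ?scale1r.
  rewrite /int_eta berezin_gvar ?size_map_enum ?signr_even ?scale1r //.
  apply/mapP => -[b _]; rewrite eta_ixE theta_ixE => /theta_eta_ix_inj/eqP.
  by rewrite eq_lrshift.
apply/mapP => -[b _] /eqP; rewrite theta_ixE theta_eta_mu //.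
Qed.

Lemma int_gparity f : I (gparity f) = gparity (I f).
Proof.
rewrite /I /int_mu /int_eta berezin_gparity size_map_enum signr_even.
by rewrite scale1r berezin_gparity size_map_enum signr_even scale1r.
Qed.

Lemma mu_ix_mono : {mono (@mu_ix n) : a b / (a < b)%N}.
Proof. by move=> a b; rewrite /= ltn_add2l. Qed.

Lemma theta_ix_mono : {mono (@theta_ix n) : a b / (a < b)%N}.
Proof. by []. Qed.

Definition gauss (X : grassmann K m) : G := I (e * gsubst (mu K (n := n)) X).

(** The integral of a total mu-derivative vanishes. The derivative falls either on the exponent,
    where it yields -i eta_b, or on X. *)
Lemma int_eta_exp b X :
  I (eta K b * (e * gsubst (mu K (n := n)) X)) = - 'i *: gauss (gderiv b X).
Proof.
have := int_gderiv_mu b (e * gsubst (mu K (n := n)) X).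
rewrite gderivD1 gderiv_exp_action gparity_gexp ?gparity_action //.
rewrite gderiv_action_mu (gsubst_gderiv mu_ix_mono) linearD /= -/(gauss _).
rewrite -!scalerAl -mulrA linearZ /= scaleNr.
move/eqP; rewrite addrC subr_eq0 => /eqP ->.
by rewrite scalerA mulNr -expr2 sqrCi opprK scale1r.
Qed.

(** The integral of a total eta-derivative vanishes. Its factor mu_a is the insertion of a variable
    into X, its theta's leave the integral, and its eta's are converted by [int_eta_exp]. *)
Lemma gauss_gvar a X :
  gauss (gvar K a * X) = \sum_b - M (rshift _ a) (lshift _ b) *: (theta K b * gauss X)
      + 'i *: \sum_b M (rshift _ a) (rshift _ b) *: gauss (gderiv b X).
Proof.
have := int_gderiv_eta a (e * gsubst (mu K (n := n)) X).
rewrite gderivD1 gderiv_exp_action gparity_gexp ?gparity_action //.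
rewrite gsubst_gderiv0; last first.
  by move=> b; rewrite eta_ixE mu_theta_eta.
rewrite mulr0 addr0 gderiv_action_eta -!scalerAl linearZ /= => /eqP.
rewrite scaler_eq0 (negPf (neq0Ci K)) /= mulrDl mulrDl linearD /= addrC addr_eq0 => /eqP.
have -> : I (mu K a * e * gsubst (mu K (n := n)) X) = gauss (gvar K a * X).
  rewrite /gauss -exp_action_central -mulrA; congr (I (_ * _)).
  by rewrite gsubst_gvar_gvarM.
move=> ->; rewrite -mulrA mulr_suml linear_sum big_split_ord /= opprD -sumrN.
congr (_ + _).
  apply: eq_bigr => b _.
  rewrite -scalerAl linearZ /= theta_eta_l int_theta -scaleNr //.
rewrite -sumrN scaler_sumr; apply: eq_bigr => b _.
rewrite -scalerAl linearZ /= theta_eta_r int_eta_exp.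
by rewrite scaleNr scalerN opprK !scalerA mulrC.
Qed.

(** A theta-derivative passes under the integral and meets only the exponent; the eta's that it
    brings down are again converted by [int_eta_exp]. *)
Lemma gderiv_gauss a X :
  gderiv (theta_ix a) (gauss X) =
     'i *: \sum_b M (lshift _ a) (lshift _ b) *: (theta K b * gauss X)
      + \sum_b M (lshift _ a) (rshift _ b) *: gauss (gderiv b X).
Proof.
rewrite /gauss -int_gderiv gderivD1 gderiv_exp_action.
rewrite gsubst_gderiv0 => [|b]; last first.
  by apply/eqP => /esym/eqP; rewrite theta_ixE theta_eta_mu.
rewrite mulr0 addr0 gderiv_action_theta -!scalerAl linearZ /= -/(gauss _).
rewrite -mulrA mulr_suml linear_sum big_split_ord /= scalerDr; congr (_ *: _ + _).
  apply: eq_bigr => b _.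
  by rewrite -scalerAl linearZ /= theta_eta_l int_theta.
rewrite scaler_sumr; apply: eq_bigr => b _.
rewrite -scalerAl linearZ /= theta_eta_r int_eta_exp.
by rewrite !scalerA mulrN mulrAC -expr2 sqrCi mulN1r opprK.
Qed.

(** The exponent is linear in mu, so each mu-derivative pulls down -i eta_a; the sign (-1)^j comes
    from passing the j eta's already produced. *)
Lemma berezin_mu_exp (s : seq 'I_m) :
  berezin [seq mu_ix a | a <- s] e =
  (\prod_(j < size s) ((-1) ^+ j * - 'i)) *:
    ((\prod_(z <- [seq eta_ix a | a <- s]) gvar K z) * e).
Proof.
elim/last_ind: s => [|s a IH].
  by rewrite /berezin /= big_ord0 big_nil mul1r scale1r.
rewrite -cats1 !map_cat {1}/berezin foldl_cat -/(berezin _ e) IH /= linearZ /=.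
rewrite size_cat addn1 big_ord_recr /= -scalerA; congr (_ *: _).
rewrite big_cat big_seq1 /= gderivD1 gderiv_exp_action.
rewrite gderiv_notin; last first.
  by apply/mapP => -[b _] /eqP; rewrite eta_ixE mu_theta_eta.
rewrite mul0r add0r gderiv_action_mu -scalerAl -scalerAr -scalerA.
rewrite gparity_prod size_map.
by rewrite -scalerAl scalerA mulrC -scalerA mulrA.
Qed.

Lemma gauss1_set0 : gauss 1 set0 = 1.
Proof.
rewrite /gauss gsubst1 mulr1 /I /int_mu berezin_mu_exp size_enum_ord.
(* Consecutive factors are -i and i, with product 1, and their number is even. *)
have -> : \prod_(j < 2 * n) ((-1) ^+ j * - 'i) = 1 :> K.
  elim: (n) => [|k IH]; first by rewrite muln0 big_ord0.
  rewrite mulnS 2!big_ord_recr /= IH exprS exprM sqrrN !expr1n !mul1r mulr1.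
  by rewrite mulN1r opprK mulNr -expr2 sqrCi opprK.
rewrite scale1r /int_eta berezin_prodM ?gexp_set0 ?action_set0 //.
by rewrite map_inj_uniq ?enum_uniq //; apply: eta_ix_inj.
Qed.

Lemma gauss_gparity X : gauss (gparity X) = gparity (gauss X).
Proof.
rewrite /gauss -int_gparity gparityM gparity_gexp ?gparity_action //.
by rewrite gsubst_gparity.
Qed.

End GaussianIntegral.

(** * Relations satisfied by a Gaussian map *)

Section GaussianMap.
Variables (K : numClosedFieldType) (n : nat).
Local Notation m := (2 * n)%N.
Variable c : 'I_m -> 'M[K]_(2 ^ n).
Hypothesis cP : clifford_generators c.
Variables (E : {linear 'M[K]_(2 ^ n) -> 'M[K]_(2 ^ n)}).
Variables (M : 'M[K]_(m + m)) (C : K) (P : 'M[K]_(2 ^ n)).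
Hypotheses (Manti : M^T = - M) (hE : gaussian_map c E M C).
Hypothesis hP : parity_operator c P.
Local Notation rep := (grassmann_rep c).
Local Notation gtheta := (gsubst (theta K (n := n))).

Lemma gaussian_mapE X : gtheta (rep (E X)) = C *: gauss M (rep X).
Proof. exact: hE. Qed.

Lemma gtheta_rep_inj X Y : gtheta (rep X) = gtheta (rep Y) -> X = Y.
Proof. by move=> /(gsubst_inj (@theta_ix_mono n))/(bij_inj (grassmann_rep_bij cP)). Qed.

Lemma gtheta_gvarM a f : gtheta (gvar K a * f) = theta K a * gtheta f.
Proof. exact: gsubst_gvar_gvarM. Qed.

Lemma gaussian_cderiv a X :
  cderiv c P a (E X) =
    'i *: (\sum_b M (lshift _ a) (lshift _ b) *: cvar c P b (E X)) +
    \sum_b M (lshift _ a) (rshift _ b) *: E (cderiv c P b X).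
Proof.
apply: gtheta_rep_inj; rewrite grassmann_rep_cderiv // -(gsubst_gderiv (@theta_ix_mono n)).
rewrite gaussian_mapE linearZ /= gderiv_gauss // scalerDr.
rewrite [rep (_ + _)]linearD [gtheta (_ + _)]linearD /=; congr (_ + _).
  rewrite [rep (_ *: _)]linearZ [gtheta (_ *: _)]linearZ /= scalerA mulrC -scalerA.
  congr (_ *: _); rewrite !linear_sum /=; apply: eq_bigr => b _.
  rewrite [rep (_ *: _)]linearZ [gtheta (_ *: _)]linearZ /= grassmann_rep_cvar // gtheta_gvarM gaussian_mapE.
  by rewrite scalerA mulrC -scalerA scalerAr.
rewrite !linear_sum /=; apply: eq_bigr => b _.
rewrite [rep (_ *: _)]linearZ [gtheta (_ *: _)]linearZ /= gaussian_mapE.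
by rewrite grassmann_rep_cderiv // !scalerA mulrC.
Qed.

Lemma gaussian_cvar a X :
  E (cvar c P a X) =
    \sum_b - M (rshift _ a) (lshift _ b) *: cvar c P b (E X) +
    'i *: (\sum_b M (rshift _ a) (rshift _ b) *: E (cderiv c P b X)).
Proof.
apply: gtheta_rep_inj.
rewrite gaussian_mapE grassmann_rep_cvar // gauss_gvar // scalerDr.
rewrite [rep (_ + _)]linearD [gtheta (_ + _)]linearD /=; congr (_ + _).
  rewrite !linear_sum /=; apply: eq_bigr => b _.
  rewrite [rep (_ *: _)]linearZ [gtheta (_ *: _)]linearZ /= grassmann_rep_cvar //.
  by rewrite gtheta_gvarM gaussian_mapE scalerA mulrC -scalerA scalerAr.
rewrite [rep (_ *: _)]linearZ [gtheta (_ *: _)]linearZ /= scalerA mulrC -scalerA.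
congr (_ *: _); rewrite !linear_sum /=; apply: eq_bigr => b _.
rewrite [rep (_ *: _)]linearZ [gtheta (_ *: _)]linearZ /= gaussian_mapE.
by rewrite grassmann_rep_cderiv // !scalerA mulrC.
Qed.

Lemma gaussian_parity X : E (P *m X *m P) = P *m E X *m P.
Proof.
apply: gtheta_rep_inj; rewrite gaussian_mapE !grassmann_rep_parity //.
by rewrite gauss_gparity -gsubst_gparity gaussian_mapE linearZ.
Qed.

(** The constant coefficient of the representation is the normalized trace, and by [gauss1_set0] the
    integral for X = 1 has constant term 1 whatever M is. *)
Lemma gaussian_trace : \tr (E 1%:M) = (2 ^ n)%:R * C.
Proof.
have d0 : (2 ^ n)%:R != 0 :> K by rewrite pnatr_eq0 -lt0n expn_gt0.
have := gaussian_mapE 1%:M; have <- : cmon c set0 = 1%:M.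
  by rewrite /cmon enum_set0 big_nil.
rewrite (grassmann_rep_cmon cP) /gmon enum_set0 big_nil.
move=> /(congr1 (fun f : grassmann K _ => f set0)); rewrite gscaleE gauss1_set0 mulr1.
rewrite -(imset0 (@theta_ix n)) (gsubst_coef (@theta_ix_mono n)).
rewrite grassmann_repE {1}/cmon enum_set0 big_nil trmx1 map_mx1 mul1mx => <-.
by rewrite mulVKf.
Qed.

End GaussianMap.

(** * Wick's rule *)

Section Contraction.
Variables (K : nzRingType) (T : Type).

(* contr h Phi w = sum_j (-1)^j h(w_j) Phi(w without its j-th letter). *)
Fixpoint contr (V : lmodType K) (h : T -> K) (Phi : seq T -> V) (w : seq T) : V :=
  if w is b :: w' then h b *: Phi w' - contr h (fun u => Phi (b :: u)) w' else 0.

Lemma eq_contr (V : lmodType K) h (Phi Psi : seq T -> V) w :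
  (forall u, (size u).+1 = size w -> Phi u = Psi u) -> contr h Phi w = contr h Psi w.
Proof.
elim: w Phi Psi => //= b w IH Phi Psi e; rewrite e //; congr (_ - _).
by apply: IH => u su; apply: e; rewrite /= su.
Qed.

Lemma contr_linear (V U : lmodType K) (f : {linear V -> U}) h (Phi : seq T -> V) w :
  f (contr h Phi w) = contr h (fun u => f (Phi u)) w.
Proof.
elim: w Phi => [|b w IH] Phi /=; first by rewrite linear0.
by rewrite linearB linearZ /= IH.
Qed.

Lemma contr0 (V : lmodType K) h w : contr h (fun=> 0 : V) w = 0.
Proof. by elim: w => //= b w ->; rewrite scaler0 subr0. Qed.

(** Anticommuting [t] through the word leaves one contraction per letter. It is used twice: for
    matrix multiplication on Clifford words, and for annihilation operators on Fock vectors. *)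
Lemma contr_anticomm (V : lmodType K) (t : {linear V -> V})
    (g : T -> {linear V -> V}) (h : T -> K) (v : V) w :
    (forall b x, t (g b x) = h b *: x - g b (t x)) ->
  t (foldr (fun b => g b) v w) =
    contr h (foldr (fun b => g b) v) w + (-1) ^+ size w *: foldr (fun b => g b) (t v) w.
Proof.
move=> tg; elim: w => [|b w IH] /=; first by rewrite add0r expr0 scale1r.
rewrite tg IH linearD linearZ /= contr_linear exprS mulN1r scaleNr.
by rewrite opprD addrA.
Qed.

End Contraction.

Lemma contrZ (K : comNzRingType) (T : Type) (V : lmodType K) (k : K) h
    (Phi : seq T -> V) w :
  contr (fun b => k * h b) Phi w = k *: contr h Phi w.
Proof.
elim: w Phi => [|b w IH] Phi /=; first by rewrite scaler0.
by rewrite IH scalerBr scalerA.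
Qed.

Lemma wick_unique (K : nzRingType) (T : Type) (W : T -> T -> K)
    (om om' : seq T -> K^o) :
    (forall a w, om (a :: w) = contr (W a) om w) ->
    (forall a w, om' (a :: w) = contr (W a) om' w) ->
    om [::] = om' [::] -> om =1 om'.
Proof.
move=> omP omP' e w; have [k] := ubnP (size w).
elim: k w => // k IH [|a w] //= wk; rewrite omP omP'; apply: eq_contr => u uw.
by apply: IH; apply: ltnW; rewrite uw.
Qed.

Section CliffordState.
Variables (K : numClosedFieldType) (D N : nat).
Variable g : 'I_N -> 'M[K]_D.
Hypothesis gP : forall a b, g a *m g b + g b *m g a = (2 * (a == b)%:R)%:M.
Variables (M : 'M[K]_N) (J : 'M[K]_D).

Definition word := foldr (fun a X => g a *m X) 1%:M.

Lemma word_cat u w : word (u ++ w) = word u *m word w.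
Proof. by elim: u => [|a u IH] /=; rewrite ?mul1mx // IH mulmxA. Qed.

Lemma word_mull w (X : 'M[K]_D) : foldr (fun a X => g a *m X) X w = word w *m X.
Proof. by elim: w => [|a w IH] /=; rewrite ?mul1mx // IH mulmxA. Qed.

Hypothesis J_kms : forall a,
  J *m g a - g a *m J = - 'i *: \sum_b M a b *: (g b *m J + J *m g b).
Hypothesis J_even : forall w, odd (size w) -> \tr (J *m word w) = 0.

Definition two_point : 'M[K]_N := 1%:M - 'i *: M.

Lemma two_pointE a b : two_point a b = (a == b)%:R - 'i * M a b.
Proof. by rewrite !mxE. Qed.

Definition state (w : seq 'I_N) : K^o := \tr (J *m word w).

Definition expect (X : 'M[K]_D) : K^o := \tr (J *m X).

Lemma expect_is_linear : linear expect.
Proof. by move=> k X Y; rewrite /expect mulmxDr mxtraceD -scalemxAr mxtraceZ. Qed.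
HB.instance Definition _ := GRing.isLinear.Build K 'M[K]_D K^o *:%R
  expect expect_is_linear.

(** With Y = sum_b M_ab g_b and T = g_a - iY, the hypothesis on J says J (g_a + iY) = T J. Splitting
    2 g_a as T + (g_a + iY) and using cyclicity of the trace gives 2 tr(J g_a w) = tr(J (T w + w
    T)). For w of odd length the bracket contracts T with the letters of w, and T anticommutes with
    g_b up to 2 W_ab. *)
Lemma state_wick a w : state (a :: w) = contr (two_point a) state w.
Proof.
have [ow|ew] := boolP (odd (size w)); last first.
  (* Here both sides are values of the functional on words of odd length, hence zero. *)
  rewrite /state J_even //= (@eq_contr _ _ _ _ _ (fun=> 0)) ?contr0 // => u uw.
  by rewrite J_even //; move: ew; rewrite -uw /= negbK.
pose T := \sum_b two_point a b *: g b.
pose Y := \sum_b M a b *: g b.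
have TE : T = g a - 'i *: Y.
  have <- : \sum_b (a == b)%:R *: g b = g a.
    rewrite (bigD1 a) //= eqxx scale1r big1 ?addr0 // => b /negPf ba.
    by rewrite eq_sym ba scale0r.
  rewrite /T /Y scaler_sumr -sumrB; apply: eq_bigr => b _.
  by rewrite two_pointE scalerBl scalerA.
have Jg : J *m g a = g a *m J - 'i *: (Y *m J + J *m Y).
  apply/eqP; rewrite addrC -subr_eq J_kms scaleNr; apply/eqP; congr (- (_ *: _)).
  rewrite mulmx_suml mulmx_sumr -big_split /=; apply: eq_bigr => b _.
  by rewrite scalerDr scalemxAl scalemxAr.
have JT : J *m (g a + 'i *: Y) = T *m J.
  rewrite TE mulmxDr mulmxBl Jg -scalemxAr -scalemxAl scalerDr opprD addrA.
  by rewrite subrK.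
have Tg b (X : 'M[K]_D) : T *m (g b *m X) = (2 * two_point a b) *: X - g b *m (T *m X).
  apply/eqP; rewrite eq_sym subr_eq eq_sym !mulmxA -mulmxDl; apply/eqP.
  rewrite -mul_scalar_mx; congr (_ *m _); rewrite mulmx_suml mulmx_sumr -big_split /=.
  rewrite (bigD1 b) //= big1 ?addr0 => [|k /negPf kb];
    rewrite -scalemxAl -scalemxAr -scalerDr gP.
    by rewrite eqxx mulr1 scale_scalar_mx mulrC.
  by rewrite kb mulr0 scale_scalar_mx mulr0 raddf0.
have := @contr_anticomm K _ _ (mulmx T) (fun b => mulmx (g b)) _ 1%:M w Tg.
rewrite -signr_odd ow expr1 scaleN1r /= mulmx1 [foldr _ T w]word_mull -/(word w) contrZ => ww.
apply: (@mulfI _ 2); first by rewrite pnatr_eq0.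
have -> : 2 * state (a :: w) = \tr (J *m (T *m word w + word w *m T)).
  have -> : 2 * state (a :: w) = \tr (J *m (2 *: g a) *m word w).
    by rewrite -scalemxAr -scalemxAl mxtraceZ -mulmxA.
  have -> : 2 *: g a = T + (g a + 'i *: Y) by rewrite TE addrACA addNr addr0 scaler_nat mulr2n.
  rewrite (mulmxDr J T) mulmxDl mxtraceD JT -!mulmxA [in RHS]mulmxDr mxtraceD.
  by congr (_ + _); rewrite mxtrace_mulC mulmxA.
rewrite ww subrK -scalemxAr mxtraceZ; congr (_ * _).
exact: (contr_linear expect).
Qed.

End CliffordState.

(** * Positive matrices *)

Section Psd.
Variable K : numClosedFieldType.

Lemma psdmx_gram p D (V : 'M[K]_(p, D)) : psdmx (V^t* *m V).
Proof.
move=> v; rewrite mulmxA -trmxC_mul -mulmxA mxE; apply: sumr_ge0 => i _.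
by rewrite !mxE mulrC mul_conjC_ge0.
Qed.

Lemma psdmx_sandwich p D (V : 'M[K]_(p, D)) Z : psdmx Z -> psdmx (V^t* *m Z *m V).
Proof.
move=> Zp v; have := Zp (V *m v); rewrite trmxC_mul.
by rewrite !mulmxA.
Qed.

Lemma psdmx_sum D (I : Type) (s : seq I) (F : I -> 'M[K]_D) :
  (forall i, psdmx (F i)) -> psdmx (\sum_(i <- s) F i).
Proof.
move=> Fp v; rewrite mulmx_sumr mulmx_suml summxE.
by apply: sumr_ge0 => i _; apply: Fp.
Qed.

Lemma psdmx_trace D (Z : 'M[K]_D) : psdmx Z -> 0 <= \tr Z.
Proof.
move=> Zp; apply: sumr_ge0 => i _; have := Zp (delta_mx i 0).
by rewrite trmx_delta map_delta_mx -rowE -colE !mxE.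
Qed.

Lemma psdmxD D (Y Z : 'M[K]_D) : psdmx Y -> psdmx Z -> psdmx (Y + Z).
Proof. by move=> Yp Zp v; rewrite mulmxDr mulmxDl mxE addr_ge0. Qed.

Lemma psdmxZ D (k : K) (Z : 'M[K]_D) : 0 <= k -> psdmx Z -> psdmx (k *: Z).
Proof. by move=> k0 Zp v; rewrite -scalemxAr -scalemxAl mxE mulr_ge0. Qed.

Lemma trmxCD p q (A B : 'M[K]_(p, q)) : (A + B)^t* = A^t* + B^t*.
Proof. by apply/matrixP => i j; rewrite !mxE rmorphD. Qed.

(** Complex polarization: the form on u + z v is examined at z = 1 and z = i. *)
Lemma quad_eq0 D (A : 'M[K]_D) :
  (forall v : 'cV[K]_D, (v^t* *m A *m v) 0 0 = 0) -> A = 0.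
Proof.
move=> A0; apply/matrixP => i j; rewrite [RHS]mxE.
pose B (u v : 'cV[K]_D) := (u^t* *m A *m v) 0 0.
have BE k l : B (delta_mx k 0) (delta_mx l 0) = A k l.
  rewrite /B trmx_delta map_delta_mx -rowE -colE !mxE //.
have BD (z : K) u v : z * B u v + z^* * B v u = 0.
  have BDl u' v' w : B (u' + v') w = B u' w + B v' w.
    by rewrite /B trmxCD !mulmxDl mxE.
  have BDr u' v' w : B w (u' + v') = B w u' + B w v' by rewrite /B mulmxDr mxE.
  have BZl y u' w : B (y *: u') w = y^* * B u' w.
    by rewrite /B trmxC_scale -!scalemxAl mxE.
  have BZr y u' w : B w (y *: u') = y * B w u' by rewrite /B -scalemxAr mxE.
  have B0 w : B w w = 0 by apply: A0.
  have := B0 (u + z *: v); rewrite BDl !BDr !BZl !BZr !B0 !mulr0 addr0 add0r.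
  by [].
rewrite -BE; have := BD 1 (delta_mx i 0) (delta_mx j 0).
have := BD 'i (delta_mx i 0) (delta_mx j 0).
rewrite conjCi rmorph1 !mul1r mulNr -mulrBr => /eqP.
rewrite mulf_eq0 (negPf (neq0Ci K)) subr_eq0 => /eqP <- /eqP.
by rewrite -mulr2n mulrn_eq0 => /eqP.
Qed.

Lemma psdmx_herm D (Z : 'M[K]_D) : psdmx Z -> Z^t* = Z.
Proof.
move=> Zp; apply/eqP; rewrite -subr_eq0; apply/eqP/quad_eq0 => v.
have -> : v^t* *m (Z^t* - Z) *m v = (v^t* *m Z *m v)^t* - v^t* *m Z *m v.
  by rewrite mulmxBr mulmxBl !trmxC_mul trmxCK mulmxA.
by move: (_ *m v) (Zp v) => q q0; rewrite !mxE geC0_conj ?subrr.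
Qed.

Lemma psdmx_tr D (Z : 'M[K]_D) : psdmx Z -> psdmx Z^T.
Proof.
move=> Zp v; have := Zp (map_mx Num.conj v).
have -> : (map_mx Num.conj v)^t* = v^T.
  by apply/matrixP => i j; rewrite !mxE conjCK.
have -> : v^t* *m Z^T *m v = (v^T *m Z *m map_mx Num.conj v)^T.
  by rewrite !trmx_mul trmxK map_trmx mulmxA.
by move=> ?; rewrite mxE.
Qed.

Lemma psdmx_of_gram D (J : 'M[K]_D) :
  (forall Y : 'M[K]_D, 0 <= \tr (J *m (Y^t* *m Y))) -> psdmx J.
Proof.
case: D J => [|D] J JY v; first by rewrite mxE big_ord0.
(* For the rank-one Y = e_0 v^* the product Y^* Y is v v^*, so the trace is the quadratic form of J
   at v. The vector e_0 is why dimension zero was split off. *)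
have := JY (delta_mx (0 : 'I_D.+1) (0 : 'I_1) *m v^t*).
rewrite trmxC_mul trmxCK -!mulmxA [(_ ^t*) *m (_ *m _)]mulmxA.
have -> : (delta_mx (0 : 'I_D.+1) (0 : 'I_1))^t* *m delta_mx 0 0 = 1%:M :> 'M[K]_1.
  by rewrite trmx_delta map_delta_mx mul_delta_mx; apply/matrixP => i j; rewrite !ord1 !mxE.
by rewrite mul1mx mulmxA mxtrace_mulC mulmxA [X in 0 <= X -> _]big_ord1.
Qed.

Lemma psdmx_factor D (Z : 'M[K]_D) : psdmx Z -> exists V : 'M[K]_D, Z = V^t* *m V.
Proof.
move=> Zp; have Zh := psdmx_herm Zp.
have /orthomx_spectralP : Z \is normalmx by apply/normalmxP; rewrite Zh.
set U := spectralmx Z; set s := spectral_diag Z => Zs.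
have Uu : U \is unitarymx by apply: spectral_unitarymx.
(* An eigenvalue is the quadratic form of Z at the corresponding eigenvector, here the adjoint of a
   row of U. *)
have s0 k : 0 <= s 0 k.
  have := Zp ((row k U)^t*); rewrite trmxCK Zs invmx_unitary //.
  have := Uu; rewrite qualifE => /eqP UU.
  have e : row k U *m U^t* = delta_mx 0 k by rewrite -row_mul UU row1.
  rewrite !mulmxA e -!mulmxA -[U *m _]trmxCK trmxC_mul trmxCK e.
  by rewrite trmx_delta map_delta_mx -colE -rowE !mxE eqxx mulr1n.
exists (diag_mx (map_mx sqrtC s) *m U).
rewrite trmxC_mul -!mulmxA [_ *m (diag_mx _ *m U)]mulmxA.
rewrite Zs invmx_unitary // -mulmxA; congr (_ *m (_ *m _)).
rewrite tr_diag_mx map_diag_mx mulmx_diag; congr diag_mx.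
apply/rowP => k; rewrite !mxE /=.
by rewrite geC0_conj ?sqrtC_ge0 // -expr2 sqrtCK.
Qed.

End Psd.

(** * Quasi-free states on Fock space *)

Section FockSpace.
Variables (K : numClosedFieldType) (N : nat) (V : 'M[K]_N).
Local Notation fock := (grassmann K N).
Implicit Types (f h : fock) (a b k : 'I_N).

Definition inner f h : K := \sum_S (f S)^* * h S.

Lemma inner_conj f h : inner f h = (inner h f)^*.
Proof.
rewrite /inner rmorph_sum /=; apply: eq_bigr => S _.
by rewrite rmorphM /= conjCK mulrC.
Qed.

Lemma inner_ge0 f : 0 <= inner f f.
Proof. by apply: sumr_ge0 => S _; rewrite mulrC mul_conjC_ge0. Qed.

Lemma inner_is_linear f : linear (inner f : fock -> K^o).
Proof.
move=> k h h'; rewrite /inner scaler_sumr -big_split /=; apply: eq_bigr => S _.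
by rewrite gaddE gscaleE mulrDr mulrCA.
Qed.
HB.instance Definition _ f := GRing.isLinear.Build K fock K^o *:%R
  (inner f : fock -> K^o) (inner_is_linear f).
Local Notation inner_linear f := (inner f : {linear fock -> K^o}).

Lemma innerDr f h h' : inner f (h + h') = inner f h + inner f h'.
Proof. exact: (linearD (inner_linear f)). Qed.

Lemma innerZr (z : K) f h : inner f (z *: h) = z * inner f h.
Proof.
by rewrite /inner mulr_sumr; apply: eq_bigr => S _; rewrite gscaleE mulrCA.
Qed.

Lemma inner_sumr (I : Type) (s : seq I) f (F : I -> fock) :
  inner f (\sum_(i <- s) F i) = \sum_(i <- s) inner f (F i).
Proof. exact: (linear_sum (inner_linear f)). Qed.

Lemma innerZl (z : K) f h : inner (z *: f) h = z^* * inner f h.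
Proof. by rewrite inner_conj innerZr rmorphM /= -inner_conj. Qed.

Lemma inner_suml (I : Type) (s : seq I) (F : I -> fock) h :
  inner (\sum_(i <- s) F i) h = \sum_(i <- s) inner (F i) h.
Proof.
rewrite inner_conj inner_sumr rmorph_sum; apply: eq_bigr => i _ /=.
by rewrite -inner_conj.
Qed.

(** Inserting and deleting [k] match the sets with and without [k] bijectively, and the same real
    sign occurs in both operations. *)
Lemma inner_gvar k f h : inner (gvar K k * f) h = inner f (gderiv k h).
Proof.
rewrite /inner (bigID (fun S : {set 'I_N} => k \in S)) /= [X in _ + X]big1 ?addr0; last first.
  by move=> S /negPf kS; rewrite gvarM kS rmorph0 mul0r.
rewrite [RHS](bigID (fun S : {set 'I_N} => k \in S)) /= [X in X + _]big1 ?add0r; last first.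
  by move=> S kS; rewrite [gderiv _ _ _]ffunE kS mulr0.
rewrite (reindex_onto (fun S : {set 'I_N} => k |: S) (fun S : {set 'I_N} => S :\ k)) /=; last first.
  by move=> S; apply: setD1K.
apply: eq_big => [S|S /andP[_ /eqP kS]].
  rewrite setU11 /=; apply/eqP/idP => [<-|]; last exact: setU1K.
  by rewrite !inE eqxx.
have nkS : k \notin S by rewrite -kS !inE eqxx.
rewrite gvarM setU11 kS [gderiv _ _ _]ffunE (negPf nkS) rmorphM /= gsign1_conj.
by rewrite [RHS]mulrCA mulrA.
Qed.

(** The conjugated coefficients make [ann a] the adjoint of [cre a] and produce V^* V as the
    anticommutator in [ann_cre]. *)
Definition ann a f : fock := \sum_k (V k a)^* *: gderiv k f.
Definition cre a f : fock := \sum_k V k a *: (gvar K k * f).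
Definition fock_field a f : fock := ann a f + cre a f.

Lemma ann_is_linear a : linear (ann a).
Proof.
move=> z f h; rewrite /ann scaler_sumr -big_split /=; apply: eq_bigr => k _.
by rewrite linearP scalerDr !scalerA mulrC.
Qed.
HB.instance Definition _ a := GRing.isLinear.Build K fock fock *:%R
  (ann a) (ann_is_linear a).

Lemma cre_is_linear a : linear (cre a).
Proof.
move=> z f h; rewrite /cre scaler_sumr -big_split /=; apply: eq_bigr => k _.
by rewrite mulrDr -scalerAr scalerDr !scalerA mulrC.
Qed.
HB.instance Definition _ a := GRing.isLinear.Build K fock fock *:%R
  (cre a) (cre_is_linear a).

Lemma fock_field_is_linear a : linear (fock_field a).
Proof. by move=> z f h; rewrite /fock_field !linearP /= scalerDr addrACA. Qed.
HB.instance Definition _ a := GRing.isLinear.Build K fock fock *:%R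
  (fock_field a) (fock_field_is_linear a).

Lemma inner_cre a f h : inner (cre a f) h = inner f (ann a h).
Proof.
rewrite inner_suml inner_sumr; apply: eq_bigr => k _.
by rewrite innerZl inner_gvar innerZr.
Qed.

Lemma inner_ann a f h : inner (ann a f) h = inner f (cre a h).
Proof. by rewrite inner_conj -inner_cre -inner_conj. Qed.

Lemma inner_fock_field a f h : inner (fock_field a f) h = inner f (fock_field a h).
Proof.
rewrite inner_conj innerDr rmorphD /= -!inner_conj.
by rewrite inner_cre inner_ann [RHS]innerDr addrC.
Qed.

Lemma ann1 a : ann a 1 = 0.
Proof. by rewrite /ann big1 // => k _; rewrite gderiv1 scaler0. Qed.

Lemma ann_ann a b f : ann a (ann b f) = - ann b (ann a f).
Proof.
rewrite /ann; under eq_bigr do rewrite linear_sum scaler_sumr.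
under [in RHS]eq_bigr do rewrite linear_sum scaler_sumr.
rewrite exchange_big -sumrN; apply: eq_bigr => k _; rewrite -sumrN.
apply: eq_bigr => l _; rewrite !linearZ /= gderiv_anticomm !scalerN !scalerA.
by rewrite mulrC.
Qed.

Lemma ann_cre a b f : ann a (cre b f) = (V^t* *m V) a b *: f - cre b (ann a f).
Proof.
rewrite /ann /cre; under eq_bigr do rewrite linear_sum scaler_sumr.
under [X in _ - X]eq_bigr do rewrite mulr_sumr scaler_sumr.
rewrite [X in _ - X]exchange_big mxE scaler_suml -sumrB; apply: eq_bigr => k _.
rewrite !mxE (eq_bigr (fun l => (k == l)%:R *: ((V k a)^* * V l b *: f) -
    V l b *: (gvar K l * ((V k a)^* *: gderiv k f)))) => [|l _]; last first.
  rewrite linearZ /= gderivM -scalerAr !scalerA scalerBr !scalerA.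
  by congr (_ *: _ - _ *: _); rewrite mulrC.
rewrite sumrB (bigD1 k) //= eqxx scale1r big1 ?addr0 // => l /negPf lk.
by rewrite eq_sym lk scale0r.
Qed.

Lemma ann_fock_field a b f : ann a (fock_field b f) = (V^t* *m V) a b *: f - fock_field b (ann a f).
Proof.
by rewrite /fock_field linearD /= ann_ann ann_cre opprD addrCA.
Qed.

Definition fock_word := foldr fock_field (1 : fock).
Definition vacuum_state (w : seq 'I_N) : K^o := inner 1 (fock_word w).

(** The first field is moved onto the left vacuum, where only its creation part survives. Moved
    back, that part becomes [ann a], which is anticommuted through the word until it kills the right
    vacuum. *)
Lemma vacuum_wick a w :
  vacuum_state (a :: w) = contr ((V^t* *m V) a) vacuum_state w.
Proof.
rewrite /vacuum_state /= -inner_fock_field [fock_field a 1]/fock_field ann1 add0r inner_cre.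
have := @contr_anticomm K _ _ (ann a) fock_field _ 1 w (ann_fock_field a).
rewrite /= ann1 => ->.
have -> : foldr fock_field 0 w = 0 by elim: w => //= b w ->; rewrite linear0.
rewrite scaler0 addr0.
exact: (contr_linear (inner_linear 1)).
Qed.

Lemma vacuum_rev u w : vacuum_state (rev u ++ w) = inner (fock_word u) (fock_word w).
Proof.
rewrite /vacuum_state /fock_word foldr_cat.
elim: u (foldr fock_field 1 w) => [//|a u IH] f.
by rewrite rev_cons -cats1 foldr_cat /= IH inner_fock_field.
Qed.

End FockSpace.

Section QuasiFree.
Variables (K : numClosedFieldType) (D N : nat).
Variable g : 'I_N -> 'M[K]_D.
Hypothesis gP : forall a b, g a *m g b + g b *m g a = (2 * (a == b)%:R)%:M.
Hypothesis g_adj : forall a, (g a)^t* = g a.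
Variables (M : 'M[K]_N) (J : 'M[K]_D).
Hypothesis J_kms : forall a,
  J *m g a - g a *m J = - 'i *: \sum_b M a b *: (g b *m J + J *m g b).
Hypothesis J_even : forall w, odd (size w) -> \tr (J *m word g w) = 0.

Lemma word_adj w : (word g w)^t* = word g (rev w).
Proof.
elim: w => [|a w IH]; first by rewrite trmx1 map_mx1.
by rewrite rev_cons -cats1 word_cat /= trmxC_mul IH g_adj mulmx1.
Qed.

Lemma quasi_free_psd (V : 'M[K]_N) :
    two_point M = V^t* *m V -> 0 <= \tr J ->
    (forall Y, exists s : seq (K * seq 'I_N), Y = \sum_(p <- s) p.1 *: word g p.2) ->
  psdmx J.
Proof.
move=> defV J0 span; apply: psdmx_of_gram => Y; have [s ->] := span Y.
(* Both functionals obey Wick's rule with the same two-point matrix, and both equal tr J on the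
   empty word. *)
have stE w : \tr (J *m word g w) = \tr J * vacuum_state V w.
  apply: (@wick_unique K _ (two_point M) (state g J)
            (fun w => \tr J * vacuum_state V w)) => [a u|a u|].
  - exact: state_wick.
  - rewrite vacuum_wick defV.
    exact: (contr_linear (GRing.scale (\tr J) : {linear K^o -> K^o})).
  rewrite /state /= mulmx1 /vacuum_state /inner (bigD1 set0) //=.
  rewrite big1 => [|S /negPf S0]; first by rewrite ffunE eqxx rmorph1 mulr1 addr0 mulr1.
  by rewrite ffunE S0 mulr0.
pose psi := \sum_(p <- s) p.1 *: fock_word V p.2.
suff -> : \tr (J *m ((\sum_(p <- s) p.1 *: word g p.2)^t* *m
    (\sum_(p <- s) p.1 *: word g p.2))) = \tr J * inner psi psi.
  by rewrite mulr_ge0 ?inner_ge0.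
have -> : (\sum_(p <- s) p.1 *: word g p.2)^t* =
    \sum_(p <- s) p.1^* *: word g (rev p.2).
  elim: (s) => [|p r IH]; first by rewrite !big_nil trmx0 map_mx0.
  by rewrite !big_cons linearD /= map_mxD IH trmxC_scale word_adj.
rewrite mulmx_suml mulmx_sumr raddf_sum /psi inner_suml mulr_sumr /=.
apply: eq_bigr => p _; rewrite mulmx_sumr mulmx_sumr raddf_sum innerZl /=.
rewrite inner_sumr !mulr_sumr /=; apply: eq_bigr => q _.
rewrite -scalemxAl -!scalemxAr !mxtraceZ -word_cat stE vacuum_rev.
rewrite innerZr.
rewrite [RHS]mulrCA; congr (_ * _); by rewrite [RHS]mulrCA.
Qed.

End QuasiFree.

(** * The Choi matrix *)

Section Choi.
Variables (K : numClosedFieldType) (d : nat).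
Implicit Types (X Y : 'M[K]_d) (phi : 'M[K]_d -> 'M[K]_d).

Definition choi phi : 'M[K]_(d * d) := \sum_i \sum_j phi (delta_mx i j) *t delta_mx i j.

Lemma tensmxDl p q (A A' : 'M[K]_p) (B : 'M[K]_q) : (A + A') *t B = A *t B + A' *t B.
Proof. by apply/matrixP => i j; rewrite !mxE mulrDl. Qed.

Lemma tensmxDr p q (A : 'M[K]_p) (B B' : 'M[K]_q) : A *t (B + B') = A *t B + A *t B'.
Proof. by apply/matrixP => i j; rewrite !mxE mulrDr. Qed.

Lemma tensmxZl p q (k : K) (A : 'M[K]_p) (B : 'M[K]_q) : (k *: A) *t B = k *: (A *t B).
Proof. by apply/matrixP => i j; rewrite !mxE mulrA. Qed.

Lemma tensmxZr p q (k : K) (A : 'M[K]_p) (B : 'M[K]_q) : A *t (k *: B) = k *: (A *t B).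
Proof. by apply/matrixP => i j; rewrite !mxE mulrCA. Qed.

Lemma tensmx_sumr p q (I : Type) (s : seq I) (A : 'M[K]_p) (B : I -> 'M[K]_q) :
  A *t (\sum_(i <- s) B i) = \sum_(i <- s) A *t B i.
Proof.
by apply/matrixP => i j; rewrite summxE !mxE summxE mulr_sumr; apply: eq_bigr => k _; rewrite mxE.
Qed.

Lemma tensmx_suml p q (I : Type) (s : seq I) (A : I -> 'M[K]_p) (B : 'M[K]_q) :
  (\sum_(i <- s) A i) *t B = \sum_(i <- s) A i *t B.
Proof.
by apply/matrixP => i j; rewrite summxE !mxE summxE mulr_suml; apply: eq_bigr => k _; rewrite mxE.
Qed.

Lemma tensmx11 p q : (1%:M : 'M[K]_p) *t (1%:M : 'M[K]_q) = 1%:M.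
Proof.
apply/matrixP => i j; case: (mxtens_indexP i) => i0 i1.
case: (mxtens_indexP j) => j0 j1; rewrite tensmxE !mxE.
by rewrite (can_eq (@mxtens_indexK _ _)) xpair_eqE -natrM mulnb.
Qed.

Lemma mxtrace_tens p q (A : 'M[K]_p) (B : 'M[K]_q) : \tr (A *t B) = \tr A * \tr B.
Proof. by rewrite /mxtrace mulr_sum; apply: eq_bigr => i _; rewrite mxE. Qed.

Lemma trmxC_tens p q (A : 'M[K]_p) (B : 'M[K]_q) : (A *t B)^t* = A^t* *t B^t*.
Proof. by rewrite trmx_tens map_mxT. Qed.

Lemma eq_choi phi psi : phi =1 psi -> choi phi = choi psi.
Proof. by move=> e; apply: eq_bigr => i _; apply: eq_bigr => j _; rewrite e. Qed.

Lemma choiD phi psi : choi (fun X => phi X + psi X) = choi phi + choi psi.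
Proof.
rewrite -big_split; apply: eq_bigr => i _; rewrite -big_split; apply: eq_bigr => j _.
exact: tensmxDl.
Qed.

Lemma choiZ k phi : choi (fun X => k *: phi X) = k *: choi phi.
Proof.
rewrite scaler_sumr; apply: eq_bigr => i _; rewrite scaler_sumr; apply: eq_bigr => j _.
exact: tensmxZl.
Qed.

Lemma choi_sum (I : Type) (s : seq I) (F : I -> 'M[K]_d -> 'M[K]_d) :
  choi (fun X => \sum_(k <- s) F k X) = \sum_(k <- s) choi (F k).
Proof.
elim: s => [|k s IH].
  rewrite big_nil (eq_choi (psi := fun X => 0 *: X)) ?choiZ ?scale0r // => X.
  by rewrite big_nil scale0r.
rewrite big_cons -IH -choiD; apply: eq_choi => X.
by rewrite big_cons.
Qed.

Lemma choi_mull1 X phi : (X *t 1%:M) *m choi phi = choi (fun Z => X *m phi Z).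
Proof.
rewrite mulmx_sumr; apply: eq_bigr => i _; rewrite mulmx_sumr; apply: eq_bigr => j _.
by rewrite tensmx_mul mul1mx.
Qed.

Lemma choi_mulr1 X phi : choi phi *m (X *t 1%:M) = choi (fun Z => phi Z *m X).
Proof.
rewrite mulmx_suml; apply: eq_bigr => i _; rewrite mulmx_suml; apply: eq_bigr => j _.
by rewrite tensmx_mul mulmx1.
Qed.

Lemma mul_delta_sum p (Y : 'M[K]_p) (i j : 'I_p) :
  Y *m delta_mx i j = \sum_k Y k i *: delta_mx k j.
Proof.
apply/matrixP => x y; rewrite !mxE summxE.
rewrite (bigD1 i) //= big1 => [|k /negPf ki]; last by rewrite mxE ki mulr0.
rewrite [RHS](bigD1 x) //= big1 => [|k /negPf kx].
  by rewrite !mxE !eqxx /= !addr0.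
by rewrite !mxE eq_sym kx mulr0.
Qed.

Lemma delta_mul_sum p (Y : 'M[K]_p) (i j : 'I_p) :
  delta_mx i j *m Y = \sum_k Y j k *: delta_mx i k.
Proof.
apply: (can_inj trmxK); rewrite trmx_mul trmx_delta mul_delta_sum linear_sum.
by apply: eq_bigr => k _; rewrite linearZ /= trmx_delta mxE.
Qed.

Section Linear.
Variable phi : {linear 'M[K]_d -> 'M[K]_d}.

(** The vector sum_i e_i (x) e_i does not distinguish Y on the second factor from Y^T on the
    first. *)
Lemma choi_mull2 Y : (1%:M *t Y) *m choi phi = choi (fun Z => phi (Y^T *m Z)).
Proof.
rewrite mulmx_sumr.
transitivity (\sum_i \sum_j \sum_k Y k i *: (phi (delta_mx i j) *t (delta_mx k j : 'M[K]_d))).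
  apply: eq_bigr => i _; rewrite mulmx_sumr; apply: eq_bigr => j _.
  rewrite tensmx_mul mul1mx mul_delta_sum tensmx_sumr; apply: eq_bigr => k _.
  exact: tensmxZr.
under eq_bigr do rewrite exchange_big /=.
rewrite exchange_big; apply: eq_bigr => k _; rewrite exchange_big.
apply: eq_bigr => j _; rewrite mul_delta_sum linear_sum tensmx_suml.
by apply: eq_bigr => i _; rewrite linearZ mxE tensmxZl.
Qed.

Lemma choi_mulr2 Y : choi phi *m (1%:M *t Y) = choi (fun Z => phi (Z *m Y^T)).
Proof.
rewrite mulmx_suml; apply: eq_bigr => i _; rewrite mulmx_suml.
transitivity (\sum_j \sum_k Y j k *: (phi (delta_mx i j) *t (delta_mx i k : 'M[K]_d))).
  apply: eq_bigr => j _.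
  rewrite tensmx_mul mulmx1 delta_mul_sum tensmx_sumr; apply: eq_bigr => k _.
  exact: tensmxZr.
rewrite exchange_big; apply: eq_bigr => k _.
rewrite delta_mul_sum linear_sum tensmx_suml.
by apply: eq_bigr => j _; rewrite linearZ mxE tensmxZl.
Qed.

Lemma mxtrace_choi : \tr (choi phi) = \tr (phi 1%:M).
Proof.
rewrite raddf_sum mx1_sum_delta linear_sum raddf_sum; apply: eq_bigr => i _.
rewrite raddf_sum (bigD1 i) //= big1 => [|j /negPf ji].
  rewrite mxtrace_tens [X in _ * X]/mxtrace (bigD1 i) //= big1 => [|j /negPf ji].
    by rewrite mxE !eqxx /= !addr0 mulr1.
  by rewrite mxE ji.
rewrite mxtrace_tens [X in _ * X]/mxtrace big1 ?mulr0 // => k _.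
by rewrite mxE; case: eqP => // ->; rewrite eq_sym ji.
Qed.

(** Every vector of the doubled space is 1 (x) U applied to sum_i e_i (x) e_i, and 1 (x) U commutes
    with E (x) Id. *)
Lemma tensor_map_rank1 (u : 'rV[K]_(d * d)) :
  tensor_map phi idfun (u^t* *m u) =
  let U := (\matrix_(k, i) (u 0 (mxtens_index (i, k)))^*) : 'M[K]_d in
  (1%:M *t U) *m choi phi *m (1%:M *t U)^t*.
Proof.
set U := \matrix_(k, i) _; rewrite /= trmxC_tens trmx1 map_mx1.
rewrite /tensor_map /choi mulmx_sumr mulmx_suml; apply: eq_bigr => i _.
rewrite mulmx_sumr mulmx_suml; apply: eq_bigr => j _.
rewrite !tensmx_mul mul1mx mulmx1 mul_delta_sum mulmx_suml tensmx_sumr.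
apply: eq_bigr => k _; rewrite -scalemxAl delta_mul_sum tensmxZr tensmx_sumr scaler_sumr.
apply: eq_bigr => l _; rewrite tensmxZr scalerA.
by rewrite !mxE big_ord1 !mxE conjCK.
Qed.

Lemma tensor_map_sum (I : Type) (s : seq I) (F : I -> 'M[K]_(d * d)) :
  tensor_map phi idfun (\sum_(r <- s) F r) = \sum_(r <- s) tensor_map phi idfun (F r).
Proof.
rewrite /tensor_map [RHS]exchange_big; apply: eq_bigr => i _ /=.
rewrite [RHS]exchange_big; apply: eq_bigr => j _ /=.
rewrite [RHS]exchange_big; apply: eq_bigr => k _ /=.
rewrite [RHS]exchange_big; apply: eq_bigr => l _ /=.
by rewrite summxE scaler_suml.
Qed.

Lemma choi_theorem : completely_positive phi <-> psdmx (choi phi).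
Proof.
split=> [cp|Jp Z Zp].
  (* The unnormalized maximally entangled vector, for which U is the identity. *)
  pose u : 'rV[K]_(d * d) := \row_x ((mxtens_unindex x).1 == (mxtens_unindex x).2)%:R.
  have := cp _ (psdmx_gram u); rewrite tensor_map_rank1 /=.
  set U := \matrix_(k, i) _; have -> : U = 1%:M.
    apply/matrixP => k i; rewrite !mxE mxtens_indexK /= conjC_nat.
    by rewrite eq_sym.
  by rewrite tensmx11 trmx1 map_mx1 mul1mx mulmx1.
have [V ->] := psdmx_factor Zp.
have -> : V^t* *m V = \sum_r (row r V)^t* *m row r V.
  apply/matrixP => x y; rewrite mxE summxE; apply: eq_bigr => r _.
  by rewrite !mxE big_ord1 !mxE.
rewrite tensor_map_sum; apply: psdmx_sum => r; rewrite tensor_map_rank1 /=.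
by rewrite -[X in X *m choi phi]trmxCK; apply: psdmx_sandwich.
Qed.

End Linear.
End Choi.

(** * Clifford generators on the doubled space *)

Section ChoiGenerators.
Variables (K : numClosedFieldType) (n : nat).
Local Notation m := (2 * n)%N.
Local Notation d := (2 ^ n)%N.
Variable c : 'I_m -> 'M[K]_d.
Hypothesis cP : clifford_generators c.
Variable P : 'M[K]_d.
Hypothesis hP : parity_operator c P.

Lemma cmon_decomp (X : 'M[K]_d) : X = \sum_S grassmann_rep c X S *: cmon c S.
Proof.
apply: (bij_inj (grassmann_rep_bij cP)).
rewrite linear_sum {1}[grassmann_rep c X]grassmann_decomp; apply: eq_bigr => S _.
by rewrite linearZ /= (grassmann_rep_cmon cP).
Qed.

Lemma clifford_ind (Q : 'M[K]_d -> Prop) :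
  Q 0 -> (forall k X Y, Q X -> Q Y -> Q (k *: X + Y)) ->
  Q 1%:M -> (forall a X, Q X -> Q (c a *m X)) -> forall X, Q X.
Proof.
move=> Q0 QD Q1 QM X; rewrite [X]cmon_decomp.
apply: big_rec => // S Y _ QY; apply: QD => //.
rewrite /cmon; elim: (enum S) => [|a s IH]; first by rewrite big_nil.
by rewrite big_cons; apply: QM.
Qed.

(* Twisting by the parity operator makes the generators of the two tensor
   factors anticommute, while no sign is left over in the Choi matrix. *)
Definition twisted a : 'M[K]_d := 'i *: (P *m c a).

(** The two blocks of indices are those of theta and eta in M. The transpose on the second factor is
    undone by [choi_mull2], so that [c a] itself multiplies the argument of E. *)
Definition choi_gen (j : 'I_(m + m)) : 'M[K]_(d * d) :=
  match split j with inl a => twisted a *t 1%:M | inr a => P *t (c a)^T end.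

Lemma choi_gen_l a : choi_gen (lshift m a) = twisted a *t 1%:M.
Proof. by rewrite /choi_gen (unsplitK (inl a)). Qed.

Lemma choi_gen_r a : choi_gen (rshift m a) = P *t (c a)^T.
Proof. by rewrite /choi_gen (unsplitK (inr a)). Qed.

Lemma twistedM a b : twisted a *m twisted b = c a *m c b.
Proof.
have [_ PP PA _] := hP.
rewrite /twisted -scalemxAl -scalemxAr scalerA -expr2 sqrCi scaleN1r.
have e : c a *m P = - (P *m c a) by rewrite PA opprK.
by rewrite -mulmxA (mulmxA (c a)) e !mulNmx mulmxN opprK !mulmxA PP mul1mx.
Qed.

Lemma twisted_parity a : P *m twisted a = - (twisted a *m P).
Proof.
have [_ _ PA _] := hP.
by rewrite /twisted -scalemxAr -scalemxAl -mulmxA -[c a *m P]opprK -PA mulmxN scalerN opprK.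
Qed.

(** As P and [c a] anticommute, their product is anti-Hermitian; this is the reason for the factor
    ['i] in [twisted]. *)
Lemma twisted_adj a : (twisted a)^t* = twisted a.
Proof.
have [Pad _ PA _] := hP.
by rewrite /twisted trmxC_scale trmxC_mul Pad cP.1 conjCi scaleNr PA scalerN.
Qed.

Lemma split_ord_ind (T : 'I_(m + m) -> Prop) :
  (forall a, T (lshift m a)) -> (forall a, T (rshift m a)) -> forall j, T j.
Proof. by move=> Tl Tr j; rewrite -[j]splitK; case: (split j). Qed.

Lemma choi_gen_anticomm j k :
  choi_gen j *m choi_gen k + choi_gen k *m choi_gen j = (2 * (j == k)%:R)%:M.
Proof.
have [_ PP PA _] := hP.
have scal z : z%:M = z *: 1%:M :> 'M[K]_(d * d) by rewrite scalemx1.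
have mixed a b : (twisted a *t 1%:M) *m (P *t (c b)^T) + (P *t (c b)^T) *m (twisted a *t 1%:M) = 0.
  rewrite !tensmx_mul mul1mx mulmx1 -tensmxDl twisted_parity subrr.
  exact: tens0mx.
elim/split_ord_ind: j => a; elim/split_ord_ind: k => b; rewrite ?choi_gen_l ?choi_gen_r.
- rewrite !tensmx_mul mulmx1 -tensmxDl !twistedM cP.2 (inj_eq (@lshift_inj _ _)).
  by rewrite scal -tensmx11 -tensmxZl scalemx1.
- by rewrite mixed eq_lrshift mulr0 raddf0.
- by rewrite addrC mixed eq_rlshift mulr0 raddf0.
rewrite !tensmx_mul PP -tensmxDr -!trmx_mul -linearD /= cP.2 (inj_eq (@rshift_inj _ _)).
by rewrite scal -tensmx11 -tensmxZr scalemx1 tr_scalar_mx eq_sym.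
Qed.

Lemma choi_gen_adj j : (choi_gen j)^t* = choi_gen j.
Proof.
have [Pad _ _ _] := hP.
elim/split_ord_ind: j => a; rewrite ?choi_gen_l ?choi_gen_r trmxC_tens.
  by rewrite twisted_adj trmx1 map_mx1.
by rewrite Pad; congr (_ *t _); rewrite -{2}(cP.1 a) map_trmx trmxK.
Qed.

Definition in_span (Y : 'M[K]_(d * d)) := exists s : seq (K * seq 'I_(m + m)),
  Y = \sum_(p <- s) p.1 *: word choi_gen p.2.

Lemma in_span_lin k Y Z : in_span Y -> in_span Z -> in_span (k *: Y + Z).
Proof.
move=> [s ->] [t ->]; exists ([seq (k * p.1, p.2) | p <- s] ++ t).
rewrite big_cat big_map scaler_sumr; congr (_ + _).
by apply: eq_bigr => p _; rewrite scalerA.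
Qed.

Lemma in_span_word w : in_span (word choi_gen w).
Proof. by exists [:: (1, w)]; rewrite big_seq1 scale1r. Qed.

Lemma in_span0 : in_span 0.
Proof. by exists [::]; rewrite big_nil. Qed.

Lemma in_spanZ k Y : in_span Y -> in_span (k *: Y).
Proof. by move=> sY; rewrite -[_ *: _]addr0; apply: in_span_lin sY in_span0. Qed.

Lemma in_span_sum (I : Type) (r : seq I) (F : I -> 'M[K]_(d * d)) :
  (forall i, in_span (F i)) -> in_span (\sum_(i <- r) F i).
Proof.
move=> sF; apply: big_rec => [|i Y _ sY]; first exact: in_span0.
by rewrite -[F i]scale1r; apply: in_span_lin.
Qed.

Lemma in_spanM Y Z : in_span Y -> in_span Z -> in_span (Y *m Z).
Proof.
move=> [s ->] [t ->]; rewrite mulmx_suml; apply: in_span_sum => p.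
rewrite mulmx_sumr; apply: in_span_sum => q.
rewrite -scalemxAl -scalemxAr -word_cat.
by do 2 apply: in_spanZ; apply: in_span_word.
Qed.

Lemma in_span_gen j : in_span (choi_gen j).
Proof. by have := in_span_word [:: j]; rewrite /= mulmx1. Qed.

Lemma in_span1 : in_span 1%:M.
Proof. exact: (in_span_word [::]). Qed.

(** A product of k twisted generators equals the untwisted product, up to a left factor ['i *: P]
    when k is odd. The product of all 2n generators, a multiple of which is P, is therefore
    unchanged by the twist. *)
Lemma in_span_parity : in_span (P *t 1%:M).
Proof.
have [_ PP PA [z Pz]] := hP.
rewrite {1}Pz tensmxZl; apply: in_spanZ.
have prodE (s : seq 'I_m) : \prod_(a <- s) twisted a =
    (if odd (size s) then 'i *: P else 1%:M) *m \prod_(a <- s) c a.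
  elim: s => [|a s IH]; first by rewrite !big_nil mulmx1.
  rewrite !big_cons -!mulmxE IH /=; case: (odd (size s)).
    rewrite /= mul1mx /twisted -!scalemxAl -!scalemxAr scalerA -expr2 sqrCi scaleN1r.
    by rewrite PA mulNmx opprK -!mulmxA [P *m (P *m _)]mulmxA PP mul1mx.
  by rewrite mul1mx /twisted -!scalemxAl mulmxA.
have -> : cmon c setT = \prod_(a <- enum [set: 'I_m]) twisted a.
  by rewrite prodE -cardE cardsT card_ord oddM mul1mx.
elim: (enum _) => [|a s IH]; first by rewrite big_nil tensmx11; apply: in_span1.
rewrite big_cons -mulmxE -[1%:M]mulmx1 -tensmx_mul -choi_gen_l.
by apply: in_spanM => //; apply: in_span_gen.
Qed.

Lemma in_span_tensl X : in_span (X *t 1%:M).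
Proof.
have [_ PP PA _] := hP.
elim/clifford_ind: X => [|k X Y sX sY||a X sX].
- by rewrite tens0mx; apply: in_span0.
- by rewrite tensmxDl tensmxZl; apply: in_span_lin.
- by rewrite tensmx11; apply: in_span1.
rewrite -[1%:M]mulmx1 -tensmx_mul; apply: in_spanM => //.
have -> : c a = - 'i *: (P *m twisted a).
  rewrite /twisted -scalemxAr scalerA mulNr -expr2 sqrCi opprK scale1r.
  by rewrite mulmxA PP mul1mx.
rewrite tensmxZl; apply: in_spanZ; rewrite -[1%:M]mulmx1 -tensmx_mul -choi_gen_l.
by apply: in_spanM; [exact: in_span_parity|exact: in_span_gen].
Qed.

Lemma in_span_tensr X : in_span (1%:M *t X^T).
Proof.
have [_ PP PA _] := hP.
elim/clifford_ind: X => [|k X Y sX sY||a X sX].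
- by rewrite trmx0 tensmx0; apply: in_span0.
- by rewrite linearP /= tensmxDr tensmxZr; apply: in_span_lin.
- by rewrite trmx1 tensmx11; apply: in_span1.
rewrite trmx_mul -[1%:M]mulmx1 -tensmx_mul; apply: in_spanM => //.
have -> : 1%:M *t (c a)^T = (P *t 1%:M) *m choi_gen (rshift m a).
  by rewrite choi_gen_r tensmx_mul PP mul1mx.
by apply: in_spanM; [exact: in_span_parity|exact: in_span_gen].
Qed.

Lemma in_span_all Y : in_span Y.
Proof.
rewrite [Y]matrix_sum_delta; apply: in_span_sum => x; apply: in_span_sum => y.
apply: in_spanZ; case: (mxtens_indexP x) => i k; case: (mxtens_indexP y) => j l.
have -> : delta_mx (mxtens_index (i, k)) (mxtens_index (j, l)) =
    (delta_mx i j *t 1%:M) *m (1%:M *t (delta_mx l k)^T) :> 'M[K]_(d * d).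
  rewrite tensmx_mul mul1mx mulmx1 trmx_delta; apply/matrixP => u v.
  case: (mxtens_indexP u) => u0 u1; case: (mxtens_indexP v) => v0 v1.
  rewrite tensmxE !mxE !(can_eq (@mxtens_indexK _ _)) !xpair_eqE -natrM mulnb.
  by rewrite andbACA.
by apply: in_spanM; [apply: in_span_tensl|apply: in_span_tensr].
Qed.

Section Map.
Variables (E : {linear 'M[K]_d -> 'M[K]_d}) (M : 'M[K]_(m + m)) (C : K).
Hypotheses (Manti : M^T = - M) (hE : gaussian_map c E M C).
Local Notation J := (choi E).
Local Notation PP1 := (P *t (1%:M : 'M[K]_d)).

Lemma choi_gen_acomm_l a : choi_gen (lshift m a) *m J + J *m choi_gen (lshift m a) =
  (2 * 'i) *: (PP1 *m choi (fun X => cvar c P a (E X))).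
Proof.
have [_ PP _ _] := hP.
rewrite choi_gen_l choi_mull1 choi_mulr1 -choiD choi_mull1 -choiZ; apply: eq_choi => X.
rewrite /cvar /twisted -[in RHS]scalemxAr scalerA mulrAC mulfV ?pnatr_eq0 // mul1r.
by rewrite mulmxDr scalerDr -scalemxAl -scalemxAr !mulmxA PP mul1mx.
Qed.

Lemma choi_gen_comm_l a : J *m choi_gen (lshift m a) - choi_gen (lshift m a) *m J =
  - (2 * 'i) *: (PP1 *m choi (fun X => cderiv c P a (E X))).
Proof.
have [_ PP _ _] := hP.
rewrite choi_gen_l choi_mull1 choi_mulr1 -scaleN1r -choiZ -choiD choi_mull1 -choiZ.
apply: eq_choi => X.
rewrite /cderiv /twisted -[in RHS]scalemxAr scalerA mulNr mulrAC mulfV ?pnatr_eq0 // mul1r.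
rewrite mulmxBr !mulmxA PP mul1mx scaleN1r scaleNr scalerBr opprB.
by rewrite -scalemxAl -scalemxAr !mulmxA.
Qed.

(** Right multiplication of J by [P *t (c a)^T] leaves P on the right of E; this moves it to the
    left, where the other terms carry it. *)
Lemma gaussian_parityr X a : P *m (E (P *m X *m P *m c a)) = - (E (X *m c a) *m P).
Proof.
have [_ PP PA _] := hP.
rewrite -mulmxA PA mulmxN linearN /= mulmxN mulmxA -(mulmxA P X).
rewrite (gaussian_parity cP hE hP).
by rewrite !mulmxA PP mul1mx.
Qed.

Lemma choi_gen_mull_r a : choi_gen (rshift m a) *m J = PP1 *m choi (fun X => E (c a *m X)).
Proof.
rewrite choi_gen_r -[P]mulmx1 -[(c a)^T]mul1mx -tensmx_mul mulmx1 -mulmxA.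
by rewrite choi_mull2 trmxK.
Qed.

Lemma choi_gen_mulr_r a : J *m choi_gen (rshift m a) =
  - (PP1 *m choi (fun X => E (P *m X *m P *m c a))).
Proof.
rewrite choi_gen_r -[P]mul1mx -[(c a)^T]mulmx1 -tensmx_mul mulmxA.
rewrite choi_mulr2 trmxK choi_mulr1 choi_mull1 -scaleN1r -choiZ.
by apply: eq_choi => X; rewrite mul1mx gaussian_parityr scaleN1r opprK.
Qed.

Lemma choi_gen_acomm_r a : choi_gen (rshift m a) *m J + J *m choi_gen (rshift m a) =
  2 *: (PP1 *m choi (fun X => E (cderiv c P a X))).
Proof.
rewrite choi_gen_mull_r choi_gen_mulr_r -mulmxBr scalemxAr -choiZ -[- choi _]scaleN1r.
rewrite -choiZ -choiD; congr (_ *m _); apply: eq_choi => X.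
by rewrite /cderiv linearZ scalerA mulfV ?pnatr_eq0 // scale1r linearB scaleN1r.
Qed.

Lemma choi_gen_comm_r a : J *m choi_gen (rshift m a) - choi_gen (rshift m a) *m J =
  - 2 *: (PP1 *m choi (fun X => E (cvar c P a X))).
Proof.
rewrite choi_gen_mull_r choi_gen_mulr_r -opprD -mulmxDr scaleNr; congr (- _).
rewrite scalemxAr -choiZ -choiD; congr (_ *m _); apply: eq_choi => X.
by rewrite /cvar linearZ scalerA mulfV ?pnatr_eq0 // scale1r linearD addrC.
Qed.

(** With the common factor [P *t 1] taken out, the theta block is [gaussian_cderiv] and the eta
    block is [gaussian_cvar]. *)
Lemma choi_kms j : J *m choi_gen j - choi_gen j *m J =
  - 'i *: \sum_k M j k *: (choi_gen k *m J + J *m choi_gen k).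
Proof.
rewrite big_split_ord /=.
under [X in _ *: (X + _)]eq_bigr do rewrite choi_gen_acomm_l scalerA.
under [X in _ *: (_ + X)]eq_bigr do rewrite choi_gen_acomm_r scalerA.
have scr (k : 'I_m -> K) (F : 'I_m -> 'M[K]_d -> 'M[K]_d) :
    \sum_a k a *: (PP1 *m choi (F a)) = PP1 *m choi (fun X => \sum_a k a *: F a X).
  rewrite choi_sum mulmx_sumr; apply: eq_bigr => a _.
  by rewrite choiZ scalemxAr.
rewrite !scr -mulmxDr -choiD scalemxAr -choiZ.
elim/split_ord_ind: j => a; rewrite ?choi_gen_comm_l ?choi_gen_comm_r scalemxAr -choiZ;
  congr (_ *m _); apply: eq_choi => X.
  rewrite (gaussian_cderiv cP Manti hE hP) !scalerDr !scaler_sumr.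
  congr (_ + _); apply: eq_bigr => b _; rewrite !scalerA; congr (_ *: _).
    by ring.
  by ring.
rewrite (gaussian_cvar cP Manti hE hP) !scalerDr !scaler_sumr.
congr (_ + _); apply: eq_bigr => b _; rewrite !scalerA; congr (_ *: _); last by ring.
have -> : - 'i * (M (rshift m a) (lshift m b) * (2 * 'i)) =
  - ('i ^+ 2) * (2 * M (rshift m a) (lshift m b)) by ring.
by rewrite sqrCi; ring.
Qed.

(** The total parity Q = P (x) P^T commutes with J, because E respects the grading, and anticommutes
    with every generator; conjugating by Q shows the trace equal to its opposite. *)
Lemma choi_even w : odd (size w) -> \tr (J *m word choi_gen w) = 0.
Proof.
have [Pad PP PA _] := hP => ow.
pose Q := P *t P^T.
have QQ : Q *m Q = 1%:M by rewrite tensmx_mul PP -trmx_mul PP trmx1 tensmx11.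
have QJ : Q *m J = J *m Q.
  have -> : Q = PP1 *m (1%:M *t P^T) by rewrite tensmx_mul mulmx1 mul1mx.
  have {2}-> : PP1 *m (1%:M *t P^T) = (1%:M *t P^T) *m PP1.
    by rewrite !tensmx_mul !mulmx1 !mul1mx.
  rewrite -mulmxA choi_mull2 mulmxA choi_mulr2 trmxK choi_mull1 choi_mulr1.
  apply: eq_choi => Z; have := gaussian_parity cP hE hP (Z *m P).
  by rewrite -!mulmxA PP mulmx1 => ->; rewrite !mulmxA PP mul1mx.
have Qg j : Q *m choi_gen j = - (choi_gen j *m Q).
  elim/split_ord_ind: j => a; rewrite ?choi_gen_l ?choi_gen_r !tensmx_mul.
    by rewrite twisted_parity mulmx1 mul1mx -[- _]scaleN1r tensmxZl scaleN1r.
  have -> : P^T *m (c a)^T = - ((c a)^T *m P^T).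
    by rewrite -!trmx_mul PA linearN opprK.
  by rewrite -[- _]scaleN1r tensmxZr scaleN1r.
have Qw u : Q *m word choi_gen u = (-1) ^+ size u *: (word choi_gen u *m Q).
  elim: u => [|j u IH]; first by rewrite scale1r mulmx1 mul1mx.
  rewrite /= -/(word choi_gen u) (mulmxA Q) Qg mulNmx -[in LHS]mulmxA IH.
  by rewrite -scalemxAr mulmxA exprS mulN1r scaleNr.
have : \tr (J *m word choi_gen w) = - \tr (J *m word choi_gen w).
  rewrite -{1}[J]mulmx1 -QQ -!mulmxA Qw -signr_odd ow expr1 scaleN1r !mulmxN.
  rewrite raddfN /=; congr (- _).
  by rewrite !mulmxA mxtrace_mulC !mulmxA QJ -(mulmxA J) QQ mulmx1.
by move/eqP; rewrite -addr_eq0 -mulr2n mulrn_eq0 => /eqP.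
Qed.

End Map.
End ChoiGenerators.

(** * Positivity of the two-point matrix *)

Section TwoPoint.
Variables (K : numClosedFieldType) (N : nat) (M : 'M[K]_N).
Hypothesis Manti : M^T = - M.
Local Notation W := (two_point M).
Local Notation H := ('i *: M).

Lemma two_point_tr : W^T = 1%:M + H.
Proof. by rewrite /two_point linearB linearZ /= trmx1 Manti scalerN opprK. Qed.

Lemma two_point_norm : W *m W^T = 1%:M - M^T *m M.
Proof.
rewrite two_point_tr /two_point mulmxBl !mulmxDr !mul1mx mulmx1.
rewrite -scalemxAl -scalemxAr scalerA -expr2 sqrCi scaleN1r opprD opprK addrA addrK.
by rewrite Manti mulNmx opprK.
Qed.

Lemma two_point_trC : W^T *m W = W *m W^T.
Proof.
rewrite two_point_tr /two_point [LHS]mulmxBr !mulmx1 mulmxDl mul1mx.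
by rewrite [RHS]mulmxBl mul1mx mulmxDr mulmx1.
Qed.

Lemma two_point_double : W + W^T = 2 *: 1%:M.
Proof. by rewrite two_point_tr /two_point addrACA addNr addr0 scaler_nat mulr2n. Qed.

Lemma two_point_herm : W^t* = W -> M \is a mxOver Num.real.
Proof.
move=> Wh; apply/mxOverP => a b; apply/CrealP.
have := congr1 (fun Z : 'M[K]_N => Z a b) Wh; rewrite !mxE eq_sym.
have /matrixP/(_ a b) := Manti; rewrite !mxE => ->.
rewrite rmorphB rmorphM /= conjCi conjC_nat => /addrI/oppr_inj.
by rewrite rmorphN mulrNN => /(mulfI (neq0Ci K)).
Qed.

Lemma two_point_real : M \is a mxOver Num.real -> W^t* = W.
Proof.
move=> /mxOverP Mr; apply/matrixP => a b; rewrite !mxE eq_sym.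
have /matrixP/(_ a b) := Manti; rewrite !mxE => ->.
by rewrite rmorphB rmorphM rmorphN /= conjCi conjC_nat mulrNN (CrealP _).
Qed.

Lemma two_point_psdP : psdmx W <->
  M \is a mxOver Num.real /\ loewner_le (M^T *m M) 1%:M.
Proof.
have half D (Z : 'M[K]_D) : psdmx (2 *: Z) -> psdmx Z.
  by move=> /(psdmxZ (k := 2^-1)); rewrite scalerA mulVf ?pnatr_eq0 // scale1r; apply; rewrite invr_ge0.
split=> [Wp|[Mr ML]].
  have Wh := psdmx_herm Wp; split; first exact: two_point_herm.
  have WTp := psdmx_tr Wp; have WTh := psdmx_herm WTp.
  apply: half; rewrite -two_point_norm.
  (* W and W^T commute and add up to 2. As both are Hermitian and non-negative, each summand is a
     positive matrix sandwiched between a matrix and its adjoint. *)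
  have -> : 2 *: (W *m W^T) = W *m W^T *m W + W^T *m W *m W^T.
    by rewrite two_point_trC -mulmxDr two_point_double -scalemxAr mulmx1.
  apply: psdmxD.
    by rewrite -{1}Wh; apply: psdmx_sandwich.
  by rewrite -{1}WTh; apply: psdmx_sandwich.
apply: half.
(* From 2W = W (W + W^T), where W is its own adjoint because M is real and antisymmetric. *)
have -> : 2 *: W = W^t* *m W + (1%:M - M^T *m M).
  rewrite two_point_real // -two_point_norm -mulmxDr two_point_double.
  by rewrite -scalemxAr mulmx1.
by apply: psdmxD => //; apply: psdmx_gram.
Qed.

End TwoPoint.

Lemma two_point_psd_of_state (K : numClosedFieldType) D N (g : 'I_N -> 'M[K]_D)
    (M : 'M[K]_N) (J : 'M[K]_D) :
    (forall a b, g a *m g b + g b *m g a = (2 * (a == b)%:R)%:M) ->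
    (forall a, (g a)^t* = g a) ->
    (forall a, J *m g a - g a *m J = - 'i *: \sum_b M a b *: (g b *m J + J *m g b)) ->
    (forall w, odd (size w) -> \tr (J *m word g w) = 0) ->
    psdmx J -> 0 < \tr J ->
  psdmx (two_point M).
Proof.
move=> gP g_adj Jk Je Jp J0 v; rewrite -(pmulr_rge0 _ J0).
pose F := \sum_b v b 0 *: g b.
have -> : \tr J * (v^t* *m two_point M *m v) 0 0 = \tr (F *m J *m F^t*).
  have -> : F^t* = \sum_a (v a 0)^* *: g a.
    apply/matrixP => i j; rewrite !mxE !summxE rmorph_sum; apply: eq_bigr => a _.
    by rewrite !mxE rmorphM /= -{2}(g_adj a) !mxE.
  rewrite -!mulmxA mxtrace_mulC -mulmxA mulmx_suml mulmx_sumr raddf_sum mxE mulr_sumr /=.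
  apply: eq_bigr => a _; rewrite [(_ *m v) a 0]mxE !mulr_sumr.
  rewrite /F !mulmx_sumr raddf_sum; apply: eq_bigr => b _ /=.
  rewrite -scalemxAl -!scalemxAr !mxtraceZ.
  have := state_wick gP Jk Je a [:: b]; rewrite /state /= mulmx1 subr0 => ->.
  by rewrite mulmx1 !mxE /=; rewrite /GRing.scale /=; ring.
rewrite -{1}[F]trmxCK; exact: (psdmx_trace (psdmx_sandwich (F^t*) Jp)).
Qed.

Lemma gaussian_cpP (K : numClosedFieldType) (n : nat) (c : 'I_(2 * n) -> 'M[K]_(2 ^ n))
    (E : {linear 'M[K]_(2 ^ n) -> 'M[K]_(2 ^ n)}) (M : 'M[K]_(2 * n + 2 * n)) (C : K) :
    clifford_generators c -> M^T = - M -> gaussian_map c E M C ->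
  (0 <= C -> psdmx (two_point M) -> completely_positive E) /\
  (C != 0 -> completely_positive E -> 0 <= C /\ psdmx (two_point M)).
Proof.
move=> cP Manti hE; have [P hP] := parity_operator_exists cP.
have gP := choi_gen_anticomm cP hP; have g_adj := choi_gen_adj cP hP.
have kms := choi_kms cP hP Manti hE; have even := choi_even cP hP hE.
have trJ : \tr (choi E) = (2 ^ n)%:R * C.
  by rewrite mxtrace_choi (gaussian_trace cP hE).
have d0 : 0 < (2 ^ n)%:R :> K by rewrite ltr0n expn_gt0.
split=> [C0 /psdmx_factor[V defV]|C0 /choi_theorem Jp].
  apply/choi_theorem; apply: (quasi_free_psd gP g_adj kms even defV).
    by rewrite trJ mulr_ge0 // ltW.
  exact: in_span_all.
have C_ge0 : 0 <= C by have := psdmx_trace Jp; rewrite trJ pmulr_rge0.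
split=> //; apply: (two_point_psd_of_state gP g_adj kms even Jp).
by rewrite trJ mulr_gt0 // lt_def C0.
Qed.

Local Open Scope complex_scope.

(** For C = 0 the map E is zero and hence completely positive for every M, so the converse
    implication is asserted for C nonzero. In that case C >= 0 makes tr J = 2^n C strictly
    positive. *)
Theorem theorem2 (R : realType) (n : nat)
    (c : 'I_(2 * n) -> 'M[R[i]]_(2 ^ n)) (hc : clifford_generators c)
    (E : {linear 'M[R[i]]_(2 ^ n) -> 'M[R[i]]_(2 ^ n)})
    (A B D : 'M[R[i]]_(2 * n)) (C : R[i])
    (hA : A^T = - A) (hD : D^T = - D)
    (hE : gaussian_map c E (block_mx A B (- B^T) D) C) :
  let M := block_mx A B (- B^T) D in
  (0 <= C /\ M \is a mxOver Num.real /\ loewner_le (M^T *m M) 1%:M ->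
     completely_positive E) /\
  (C != 0 -> completely_positive E ->
     0 <= C /\ M \is a mxOver Num.real /\ loewner_le (M^T *m M) 1%:M).
Proof.
move=> M; have Manti : M^T = - M.
  by rewrite tr_block_mx hA hD linearN /= trmxK opp_block_mx opprK.
have [suf nec] := gaussian_cpP hc Manti hE; split.
  by move=> [C0 /(two_point_psdP Manti)]; apply: suf.
by move=> C0 /(nec C0)[C_ge0 /(two_point_psdP Manti)].
Qed.
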